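(* Let $\mathbb{K}=\mathbb{R}$ or $\mathbb{C}$ and let $L$ be a differential graded Lie algebra over $\mathbb{K}$ with finite-dimensional total cohomology $\bigoplus_i H^i(L)$. If $L$ is abelian (its Lie bracket vanishes identically), then the graded deformation functor $Def^{\mathbb{Z}}_L$ is pro-representable.
   Context: A differential graded Lie algebra (DGLA) $L=\bigoplus_{i\in\mathbb{Z}}L^i$ is a graded vector space with differential $d:L^i\to L^{i+1}$, $d^2=0$, and a bilinear bracket $L^i\times L^j\to L^{i+j}$ which is graded antisymmetric, satisfies the graded Jacobi identity, and for which $d$ is a graded derivation. A graded Artin algebra $A$ is a local $\mathbb{Z}$-graded (graded-commutative) Artin $\mathbb{K}$-algebra with residue field $\mathbb{K}$; its maximal ideal is $\mathfrak m_A$ (nilpotent), and $g\mathbf{Art}_{\mathbb{K}}$ is the category of such algebras. For such $A$, the DGLA $L\otimes\mathfrak m_A$ is defined by $(L\otimes\mathfrak m_A)^k=\bigoplus_{i-j=k}L^i\otimes\mathfrak m_A^j$ (upper index $j$ denotes degree), $d(l\otimes a)=dl\otimes a$, $[l_1\otimes a_1,l_2\otimes a_2]=(-1)^{\deg(l_2)\deg(a_1)}[l_1,l_2]\otimes a_1a_2$. The graded deformation functor is $$Def^{\mathbb{Z}}_L:g\mathbf{Art}_{\mathbb{K}}\to\mathbf{Set},\qquad A\mapsto\frac{\{x\in(L\otimes\mathfrak m_A)^1\mid dx+\frac12[x,x]=0\}}{\exp((L\otimes\mathfrak m_A)^0)},$$ where $\exp((L\otimes\mathfrak m_A)^0)$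 acts by the gauge action $\exp(ad_a)*b=b+\sum_{n\ge0}\frac{(ad_a)^n}{(n+1)!}([a,b]-da)$, $ad_a=[a,\cdot]$. A pro-Artin graded algebra is an algebra of the form $\mathbb{K}[[t_1,\dots,t_n]]/I$, where $\mathbb{K}[[t_1,\dots,t_n]]$ is the algebra of formal power series on (finitely many) graded variables and $I$ is an ideal. $Def^{\mathbb{Z}}_L$ is pro-representable if there is a pro-Artin graded algebra $R$ with $Def^{\mathbb{Z}}_L\cong h_R$ as functors, where $h_R(A)=\mathrm{Hom}(R,A)$ is the set of morphisms of graded local algebras. *)

(* Defs.v *)
From HB Require Import structures.
From mathcomp Require Import all_boot all_order all_algebra finmap.
From mathcomp Require Import all_classical all_reals.
From mathcomp Require Import generic_quotient ring_quotient.
From mathcomp Require Import complex.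
From Stdlib Require Import Relation_Operators.

Set Implicit Arguments.
Unset Strict Implicit.
Unset Printing Implicit Defensive.

Import Order.TTheory GRing.Theory Num.Theory.
Local Open Scope classical_set_scope.
Local Open Scope ring_scope.
Local Open Scope quotient_scope.

Notation bilin f := (bilinear_for *:%R *:%R f).

Section LinearFacts.
Variables (K : fieldType) (U V : lmodType K) (f : U -> V).
Hypothesis f_lin : linear f.

Lemma lin0 : f 0 = 0.
Proof. by have := @f_lin (-1) 0 0; rewrite scaleN1r oppr0 addr0 scaleN1r addNr. Qed.
Lemma linD x y : f (x + y) = f x + f y.
Proof. by rewrite -{1}[x]scale1r f_lin scale1r. Qed.
Lemma linZ a x : f (a *: x) = a *: f x.
Proof. by rewrite -{1}[a *: x]addr0 f_lin lin0 addr0. Qed.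
Lemma linN x : f (- x) = - f x.
Proof. by rewrite -scaleN1r linZ scaleN1r. Qed.
Lemma linB x y : f (x - y) = f x - f y.
Proof. by rewrite linD linN. Qed.
Lemma lin_sum (J : Type) (r : seq J) (P : pred J) (F : J -> U) :
  f (\sum_(j <- r | P j) F j) = \sum_(j <- r | P j) f (F j).
Proof. exact: (big_morph f linD lin0). Qed.
End LinearFacts.

Section Subspaces.
Variables (K : fieldType) (V : lmodType K).

Record subspace := Subspace {
  in_subspace :> V -> Prop;
  subspace0 : in_subspace 0;
  subspaceP : forall (a : K) (x y : V),
    in_subspace x -> in_subspace y -> in_subspace (a *: x + y) }.

Definition subspace_pred (S : subspace) : V -> bool := fun x => `[< S x >].

Lemma subspace_pred_closed S : GRing.submod_closed (subspace_pred S).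
Proof.
split=> [|a x y /asboolP xS /asboolP yS]; apply/asboolP.
  exact: subspace0.
exact: subspaceP.
Qed.
HB.instance Definition _ S := GRing.isSubmodClosed.Build K V (subspace_pred S)
  (subspace_pred_closed S).

Lemma subspaceD (S : subspace) x y : S x -> S y -> S (x + y).
Proof. by move=> xS yS; rewrite -[x]scale1r; apply: subspaceP. Qed.

Lemma subspaceZ (S : subspace) a x : S x -> S (a *: x).
Proof. by move=> xS; rewrite -[_ *: _]addr0; apply: subspaceP => //; apply: subspace0. Qed.

Lemma subspaceB (S : subspace) x y : S x -> S y -> S (x - y).
Proof. by move=> xS yS; rewrite -scaleN1r addrC; apply: subspaceP. Qed.

Definition submod (S : subspace) := {x : V | x \in subspace_pred S}.
HB.instance Definition _ S := SubType.on (submod S).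
HB.instance Definition _ S := Choice.on (submod S).
HB.instance Definition _ S := [SubChoice_isSubLmodule of submod S by <:].

Definition to_submod (S : subspace) x (xS : S x) : submod S :=
  exist _ x (asboolT xS).

Lemma submodP (S : subspace) (x : submod S) : S (val x).
Proof. by apply/asboolP; exact: (valP x). Qed.

Definition quotmod (S : subspace) := Quotient.quot (GRing.ZmodClosed.clone V (subspace_pred S) _).
HB.instance Definition _ S := GRing.Zmodule.on (quotmod S).
HB.instance Definition _ S := EqQuotient.on (quotmod S).

Section QuotScale.
Variable S : subspace.

Definition topi (x : V) : quotmod S := \pi x.
Definition quot_scale (a : K) (x : quotmod S) : quotmod S := topi (a *: repr x).

Lemma topiP x y : topi x = topi y <-> S (x - y).
Proof.
split=> [/eqP|xyS]; last apply/eqP.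
  by rewrite -Quotient.idealrBE => /asboolP.
by rewrite -Quotient.idealrBE; apply/asboolP.
Qed.

Lemma repr_topi x : S (repr (topi x) - x).
Proof. by apply/topiP; rewrite /topi reprK. Qed.

Lemma topiK x : topi (repr x) = x.
Proof. by rewrite /topi reprK. Qed.

Lemma topiD : {morph topi : x y / x + y}.
Proof. by move=> x y; rewrite /topi !piE. Qed.

Lemma quot_scaleE a x : quot_scale a (topi x) = topi (a *: x).
Proof. by apply/topiP; rewrite -scalerBr; apply: subspaceZ; apply: repr_topi. Qed.

Lemma quot_scaleA a b x : quot_scale a (quot_scale b x) = quot_scale (a * b) x.
Proof. by rewrite -[x]topiK !quot_scaleE scalerA. Qed.
Lemma quot_scale1 : left_id 1 quot_scale.
Proof. by move=> x; rewrite -[x]topiK quot_scaleE scale1r. Qed.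
Lemma quot_scaleDr : right_distributive quot_scale +%R.
Proof.
by move=> a x y; rewrite -[x]topiK -[y]topiK -topiD !quot_scaleE -topiD scalerDr.
Qed.
Lemma quot_scaleDl v : {morph quot_scale^~ v : a b / a + b}.
Proof. by move=> a b /=; rewrite -[v]topiK !quot_scaleE -topiD scalerDl. Qed.

HB.instance Definition _ := GRing.Zmodule_isLmodule.Build K (quotmod S)
  quot_scaleA quot_scale1 quot_scaleDr quot_scaleDl.

Lemma topi_linear : linear topi.
Proof. by move=> a x y; rewrite topiD -quot_scaleE. Qed.
HB.instance Definition _ := GRing.isLinear.Build K V (quotmod S) *:%R topi topi_linear.
End QuotScale.

Lemma subspace_span_subproof (X : set V) (a : K) x y :
  (forall S : subspace, X `<=` S -> S x) ->
  (forall S : subspace, X `<=` S -> S y) ->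
  forall S : subspace, X `<=` S -> S (a *: x + y).
Proof. by move=> hx hy S XS; apply: subspaceP; [apply: hx|apply: hy]. Qed.

Definition subspace_span (X : set V) : subspace :=
  @Subspace [set x | forall S : subspace, X `<=` S -> S x]
    (fun S _ => subspace0 S) (@subspace_span_subproof X).

Lemma sub_subspace_span (X : set V) : X `<=` subspace_span X.
Proof. by move=> x Xx S; apply. Qed.

Definition findim :=
  exists (n : nat) (b : 'I_n -> V),
    forall v, exists c : 'I_n -> K, v = \sum_(i < n) c i *: b i.

End Subspaces.

Section DirectSum.
Variables (K : fieldType) (I : choiceType) (V : I -> lmodType K).

Definition dprod := forall i, V i.
HB.instance Definition _ := gen_eqMixin dprod.
HB.instance Definition _ := gen_choiceMixin dprod.

Definition dprod_add (x y : dprod) : dprod := fun i => x i + y i.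
Definition dprod_opp (x : dprod) : dprod := fun i => - x i.
Definition dprod_scale (a : K) (x : dprod) : dprod := fun i => a *: x i.

Fact dprod_addA : associative dprod_add.
Proof. by move=> x y z; apply: functional_extensionality_dep => i; rewrite /dprod_add addrA. Qed.
Fact dprod_addC : commutative dprod_add.
Proof. by move=> x y; apply: functional_extensionality_dep => i; rewrite /dprod_add addrC. Qed.
Fact dprod_add0 : left_id ((fun i => 0) : dprod) dprod_add.
Proof. by move=> x; apply: functional_extensionality_dep => i; rewrite /dprod_add add0r. Qed.
Fact dprod_addN : left_inverse ((fun i => 0) : dprod) dprod_opp dprod_add.
Proof. by move=> x; apply: functional_extensionality_dep => i; rewrite /dprod_add addNr. Qed.
HB.instance Definition _ :=
  GRing.isZmodule.Build dprod dprod_addA dprod_addC dprod_add0 dprod_addN.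

Fact dprod_scaleA a b x : dprod_scale a (dprod_scale b x) = dprod_scale (a * b) x.
Proof. by apply: functional_extensionality_dep => i; apply: scalerA. Qed.
Fact dprod_scale1 : left_id 1 dprod_scale.
Proof. by move=> x; apply: functional_extensionality_dep => i; apply: scale1r. Qed.
Fact dprod_scaleDr : right_distributive dprod_scale +%R.
Proof. by move=> a x y; apply: functional_extensionality_dep => i; apply: scalerDr. Qed.
Fact dprod_scaleDl v : {morph dprod_scale^~ v : a b / a + b}.
Proof. by move=> a b; apply: functional_extensionality_dep => i; apply: scalerDl. Qed.
HB.instance Definition _ := GRing.Zmodule_isLmodule.Build K dprod
  dprod_scaleA dprod_scale1 dprod_scaleDr dprod_scaleDl.

Definition supp (x : dprod) : set I := [set i | x i != 0].

Fact supp0_finite : finite_set (supp 0).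
Proof. by apply: (sub_finite_set _ (finite_set0 I)) => i; rewrite /supp /= eqxx. Qed.

Fact suppP_finite a x y : finite_set (supp x) -> finite_set (supp y) ->
  finite_set (supp (a *: x + y)).
Proof.
move=> fx fy; have fxy : finite_set (supp x `|` supp y) by rewrite finite_setU.
apply: (sub_finite_set _ fxy) => i; rewrite /supp /=.
have -> : (a *: x + y) i = a *: x i + y i by [].
have [-> | xi0 _] := eqVneq (x i) 0; last by left.
by rewrite scaler0 add0r; right.
Qed.

Definition finsupp : subspace dprod :=
  @Subspace _ _ [set x | finite_set (supp x)] supp0_finite suppP_finite.

Definition dsum := submod finsupp.
HB.instance Definition _ := GRing.Lmodule.on dsum.

Definition dcomp (x : dsum) (i : I) : V i := (val x : dprod) i.

Definition dinj_fun (i : I) (v : V i) : dprod := fun j =>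
  if eqP is ReflectT e then ecast k (V k) (e : i = j) v else 0.

Arguments dinj_fun : simpl never.

Lemma dinj_funE i (v : V i) : dinj_fun v i = v.
Proof. by rewrite /dinj_fun; case: eqP => // e; rewrite eq_axiomK. Qed.

Lemma dinj_fun_neq i (v : V i) j : i <> j -> dinj_fun v j = 0 :> V j.
Proof. by move=> ne; rewrite /dinj_fun; case: eqP. Qed.

Fact dinj_finsupp i (v : V i) : finsupp (dinj_fun v).
Proof.
apply: (sub_finite_set _ (finite_set1 i)) => j; rewrite /supp /=.
by have [eij|/eqP ij] := eqVneq i j; [move=> _; exact: esym|rewrite (dinj_fun_neq v ij) eqxx].
Qed.

Definition dinj (i : I) (v : V i) : dsum := to_submod (dinj_finsupp v).

Definition dlift (W : lmodType K) (f : forall i, V i -> W) (x : dsum) : W :=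
  \sum_(i \in [set: I]) f i (dcomp x i).

Lemma dsum_eqP (x y : dsum) : (forall i, dcomp x i = dcomp y i) -> x = y.
Proof. by move=> xy; apply: val_inj; apply: functional_extensionality_dep. Qed.

Lemma dcompP i : linear (dcomp^~ i).
Proof. by []. Qed.
Lemma dcompD x y i : dcomp (x + y) i = dcomp x i + dcomp y i. Proof. by []. Qed.
Lemma dcompZ a x i : dcomp (a *: x) i = a *: dcomp x i. Proof. by []. Qed.
Lemma dcomp0 i : dcomp 0 i = 0. Proof. by []. Qed.

Lemma dcomp_inj i (v : V i) : dcomp (dinj v) i = v. Proof. exact: dinj_funE. Qed.
Lemma dcomp_inj_neq i (v : V i) j : i <> j -> dcomp (@dinj i v) j = 0.
Proof. exact: (@dinj_fun_neq i v j). Qed.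

Lemma dinj_linear i : linear (@dinj i).
Proof.
move=> a u v; apply: dsum_eqP => j; rewrite dcompD dcompZ.
have [<- | /eqP ij] := eqVneq i j; first by rewrite !dcomp_inj.
by rewrite !dcomp_inj_neq // scaler0 addr0.
Qed.
HB.instance Definition _ i := GRing.isLinear.Build K (V i) dsum *:%R (@dinj i) (@dinj_linear i).

Lemma dinj_inj i : injective (@dinj i).
Proof. by move=> u v uv; rewrite -[u]dcomp_inj uv dcomp_inj. Qed.

Section Lift.
Variables (W : lmodType K) (f : forall i, V i -> W).
Hypothesis f_lin : forall i, linear (@f i).

Let f0 i : @f i 0 = 0.
Proof. exact: lin0. Qed.

Lemma dliftE (x : dsum) (A : set I) : finite_set A -> supp (val x) `<=` A ->
  dlift f x = \sum_(i \in A) f (dcomp x i).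
Proof.
move=> Af xA; rewrite /dlift; apply: esym; apply: fsbig_widen => // i /= [_ Ai].
apply: contra_notP Ai => fi; apply: xA; rewrite /supp /=.
by apply/eqP => xi0; apply: fi; rewrite (xi0 : dcomp x i = 0) f0.
Qed.

Lemma dlift_linear : linear (dlift f).
Proof.
move=> a x y.
have fA : finite_set (supp (val x) `|` supp (val y)).
  by rewrite finite_setU; split; [exact: (submodP x)|exact: (submodP y)].
have sx : supp (val x) `<=` supp (val x) `|` supp (val y) by move=> i; left.
have sy : supp (val y) `<=` supp (val x) `|` supp (val y) by move=> i; right.
have sxy : supp (val (a *: x + y)) `<=` supp (val x) `|` supp (val y).
  move=> i sxi; have [x0|x0] := eqVneq (dcomp x i) 0; last by left.
  have : dcomp (a *: x + y) i != 0 by exact: sxi.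
  by rewrite dcompD dcompZ x0 scaler0 add0r; right.
rewrite (dliftE fA sx) (dliftE fA sy) (dliftE fA sxy).
rewrite !fsbig_finite //= scaler_sumr -big_split /=.
by apply: eq_bigr => i _; rewrite dcompD dcompZ f_lin.
Qed.

Lemma dlift_inj i v : dlift f (@dinj i v) = f v.
Proof.
rewrite (dliftE (finite_set1 i)) ?fsbig_set1 ?dcomp_inj //.
move=> j; rewrite /supp /=.
by have [eij|/eqP ij] := eqVneq i j; [move=> _; exact: esym|rewrite (dinj_fun_neq v ij) eqxx].
Qed.
End Lift.

Lemma dsum_ind (P : set dsum) : P 0 -> (forall x y, P x -> P y -> P (x + y)) ->
  (forall i v, P (@dinj i v)) -> forall x, P x.
Proof.
move=> P0 PD Pi x.
have xf : finite_set (supp (val x)) by exact: (submodP x).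
have -> : x = \sum_(i <- fset_set (supp (val x))) dinj (dcomp x i).
  apply: dsum_eqP => j.
  rewrite (big_morph (dcomp^~ j) (fun u v => dcompD u v j) (dcomp0 j)).
  have [jx|jx] := boolP (j \in fset_set (supp (val x))).
    rewrite (bigD1_seq j) ?fset_uniq //= dcomp_inj big1 ?addr0 // => i /eqP ij.
    by rewrite dcomp_inj_neq.
  rewrite big_seq big1 => [|i ix].
    by move: jx; rewrite in_fset_set // notin_setE => /negP; rewrite negbK => /eqP.
  by rewrite dcomp_inj_neq // => ij; rewrite -ij ix in jx.
by apply: (big_ind P) => //.
Qed.

Lemma dsum_ext (W : lmodType K) (f g : dsum -> W) : linear f -> linear g ->
  (forall i v, f (@dinj i v) = g (dinj v)) -> f =1 g.
Proof.
move=> fl gl fg; apply: dsum_ind => //.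
- by rewrite (lin0 fl) (lin0 gl).
- by move=> x y fx fy; rewrite (linD fl) (linD gl) fx fy.
Qed.
End DirectSum.

Arguments dinj {K I V i} v.

Section Tensor.
Variables (K : fieldType) (V W : lmodType K).

(* the vector space with basis [V * W], [freemod_gen v w] being a basis element *)
Definition freemod := dsum (fun _ : V * W => K^o : lmodType K).
HB.instance Definition _ := GRing.Lmodule.on freemod.
Definition freemod_gen (v : V) (w : W) : freemod :=
  @dinj K _ (fun _ : V * W => K^o : lmodType K) (v, w) 1.

Definition tensor_rel : set freemod :=
  [set z | exists a v v' w,
     z = freemod_gen (a *: v + v') w - (a *: freemod_gen v w + freemod_gen v' w)] `|`
  [set z | exists a v w w',
     z = freemod_gen v (a *: w + w') - (a *: freemod_gen v w + freemod_gen v w')].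

Definition tensor := quotmod (subspace_span tensor_rel).
HB.instance Definition _ := GRing.Lmodule.on tensor.

Definition tens (v : V) (w : W) : tensor := topi (subspace_span tensor_rel) (freemod_gen v w).

(* The linear map out of the tensor product induced by a bilinear [f]. *)
Definition tlift (U : lmodType K) (f : V -> W -> U) (t : tensor) : U :=
  dlift (fun p (c : K^o) => c *: f p.1 p.2) (repr t).

Lemma tens_bilin : bilin tens.
Proof.
split=> [w a v v'|v a w w'] /=; rewrite /tens -topi_linear; apply/topiP; apply: sub_subspace_span.
  by left; exists a, v, v', w.
by right; exists a, v, w, w'.
Qed.

Section TLift.
Variables (U : lmodType K) (f : V -> W -> U).
Hypothesis f_bil : bilin f.

Let g (p : V * W) (c : K^o) := c *: f p.1 p.2.

Let g_lin p : linear (g p).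
Proof. by move=> a x y; rewrite /g scalerDl scalerA. Qed.

Let ker_subspace0 : (dlift g 0 = 0 :> U). Proof. exact: lin0 (dlift_linear g_lin). Qed.
Let ker_subspaceP a x y : dlift g x = 0 -> dlift g y = 0 -> dlift g (a *: x + y) = 0.
Proof. by move=> x0 y0; rewrite (dlift_linear g_lin) x0 y0 scaler0 addr0. Qed.

Let g_gen v w : dlift g (freemod_gen v w) = f v w.
Proof. by rewrite /freemod_gen (dlift_inj g_lin) /g scale1r. Qed.

Let g_span z : subspace_span tensor_rel z -> dlift g z = 0.
Proof.
move=> /(_ (@Subspace _ _ [set z | dlift g z = 0] ker_subspace0 ker_subspaceP)); apply.
have gl := dlift_linear g_lin.
move=> _ [[a [v [v' [w ->]]]]|[a [v [w [w' ->]]]]] /=;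
  rewrite (linB gl) gl !g_gen; apply/eqP; rewrite subr_eq0; apply/eqP.
  exact: f_bil.1.
exact: f_bil.2.
Qed.

Lemma tlift_topi z : tlift f (topi _ z) = dlift g z.
Proof.
apply/eqP; rewrite -subr_eq0 -(linB (dlift_linear g_lin)); apply/eqP/g_span.
exact: repr_topi.
Qed.

Lemma tlift_tens v w : tlift f (tens v w) = f v w.
Proof. by rewrite /tens tlift_topi g_gen. Qed.

Lemma tlift_linear : linear (tlift f).
Proof.
move=> a x y; rewrite -[x]topiK -[y]topiK -topi_linear !tlift_topi.
by rewrite (dlift_linear g_lin).
Qed.
End TLift.

Lemma tensor_ext (U : lmodType K) (f g : tensor -> U) : linear f -> linear g ->
  (forall v w, f (tens v w) = g (tens v w)) -> f =1 g.
Proof.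
move=> fl gl fg t; rewrite -[t]topiK; move: (repr t).
apply: dsum_ext => [a x y|a x y|[v w] c]; rewrite ?topi_linear ?fl ?gl //.
have -> : @dinj K _ (fun _ : V * W => K^o : lmodType K) (v, w) c = c *: freemod_gen v w.
  rewrite -[c in LHS](mulr1 c).
  exact: (linZ (@dinj_linear K _ (fun _ : V * W => K^o : lmodType K) (v, w)) c 1).
rewrite (linZ (@topi_linear _ _ _)) (linZ fl) (linZ gl); congr (_ *: _); exact: fg.
Qed.
End Tensor.

Arguments tens {K V W} v w.
Arguments tensor {K} V W.

Section GradedAlgebras.
Variable K : fieldType.

(* A graded vector space is a family [V : int -> lmodType K]; its total
   space is [dsum V], with [dinj] the inclusion of the homogeneous
   elements.  Identities between homogeneous elements whose degrees are
   only propositionally equal are stated in the total space. *)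

Definition ksign (n : int) : K := (-1) ^ n.

Record galg := GAlg {
  gsort :> int -> lmodType K;
  gone : gsort 0;
  gmul : forall i j, gsort i -> gsort j -> gsort (i + j);
  gmul_bilin : forall i j, bilin (@gmul i j);
  gmul1 : forall i (x : gsort i), dinj (gmul gone x) = dinj x;
  gmulA : forall i j k (x : gsort i) (y : gsort j) (z : gsort k),
    dinj (gmul x (gmul y z)) = dinj (gmul (gmul x y) z);
  gmulC : forall i j (x : gsort i) (y : gsort j),
    dinj (gmul x y) = ksign (i * j) *: dinj (gmul y x) }.

Record ghom (A B : galg) := GHom {
  gfun :> forall i, A i -> B i;
  gfun_linear : forall i, linear (@gfun i);
  gfun1 : gfun (gone A) = gone B;
  gfunM : forall i j (x : A i) (y : A j),
    gfun (gmul x y) = gmul (gfun x) (gfun y) }.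
Arguments gfun {A B} g i x : rename.

Definition giso (A B : galg) : Prop :=
  exists f : ghom A B, forall i, bijective (f i).

(* homogeneous two-sided ideals *)
Record gideal (A : galg) := GIdeal {
  gid :> forall i, subspace (A i);
  gid_mull : forall i j (a : A i) (x : A j), gid j x -> gid (i + j) (gmul a x);
  gid_mulr : forall i j (x : A i) (a : A j), gid i x -> gid (i + j) (gmul x a) }.

Section Quotient.
Variables (A : galg) (I : gideal A).

Definition gquot_sort (i : int) : lmodType K := quotmod (I i).
Definition gquot_one : gquot_sort 0 := topi (I 0) (gone A).
Definition gquot_mul i j (x : gquot_sort i) (y : gquot_sort j) : gquot_sort (i + j) :=
  topi (I (i + j)) (gmul (repr x) (repr y)).

Lemma gmulDl i j (x x' : A i) (y : A j) : gmul (x + x') y = gmul x y + gmul x' y.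
Proof. exact: (linD ((@gmul_bilin A i j).1 y)). Qed.
Lemma gmulDr i j (x : A i) (y y' : A j) : gmul x (y + y') = gmul x y + gmul x y'.
Proof. exact: (linD ((@gmul_bilin A i j).2 x)). Qed.
Lemma gmulBl i j (x x' : A i) (y : A j) : gmul (x - x') y = gmul x y - gmul x' y.
Proof. exact: (linB ((@gmul_bilin A i j).1 y)). Qed.
Lemma gmulBr i j (x : A i) (y y' : A j) : gmul x (y - y') = gmul x y - gmul x y'.
Proof. exact: (linB ((@gmul_bilin A i j).2 x)). Qed.

Lemma gquot_mulE i j (x : A i) (y : A j) :
  gquot_mul (topi (I i) x) (topi (I j) y) = topi (I (i + j)) (gmul x y).
Proof.
apply/topiP; set x' := repr _; set y' := repr _.
have -> : gmul x' y' - gmul x y = gmul (x' - x) y' + gmul x (y' - y).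
  by rewrite gmulBl gmulBr addrA subrK.
apply: subspaceD; [apply: gid_mulr|apply: gid_mull]; exact: repr_topi.
Qed.

Lemma gquot_mul_bilin i j : bilin (@gquot_mul i j).
Proof.
split=> [y a x x'|x a y y'] /=.
  rewrite -[x]topiK -[x']topiK -[y]topiK -topi_linear !gquot_mulE.
  by rewrite ((@gmul_bilin A i j).1 _) topi_linear.
rewrite -[x]topiK -[y']topiK -[y]topiK -topi_linear !gquot_mulE.
by rewrite ((@gmul_bilin A i j).2 _) topi_linear.
Qed.

Lemma dinj_map (V W : int -> lmodType K) (f : forall i, V i -> W i) i j
    (x : V i) (y : V j) (a : K) : (forall i, linear (f i)) ->
  dinj x = a *: dinj y -> dinj (f i x) = a *: dinj (f j y).
Proof.
move=> fl xy; pose g i v := dinj (f i v).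
have gl i' : linear (@g i') by move=> b u v; rewrite /g fl dinj_linear.
by rewrite -/(g i x) -/(g j y) -!(dlift_inj gl) xy (linZ (dlift_linear gl)).
Qed.

Lemma dinj_map1 (V W : int -> lmodType K) (f : forall i, V i -> W i) i j
    (x : V i) (y : V j) : (forall i, linear (f i)) ->
  dinj x = dinj y -> dinj (f i x) = dinj (f j y).
Proof.
move=> fl xy; rewrite -[RHS]scale1r; apply: (dinj_map fl); by rewrite scale1r.
Qed.

Let pl i : linear (@topi K (A i) (I i)). Proof. exact: topi_linear. Qed.

Lemma gquot_mul1 i (x : gquot_sort i) : dinj (gquot_mul gquot_one x) = dinj x.
Proof. by rewrite -[x]topiK gquot_mulE; apply: (dinj_map1 pl); apply: gmul1. Qed.

Lemma gquot_mulA i j k (x : gquot_sort i) (y : gquot_sort j) (z : gquot_sort k) :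
  dinj (gquot_mul x (gquot_mul y z)) = dinj (gquot_mul (gquot_mul x y) z).
Proof.
rewrite -[x]topiK -[y]topiK -[z]topiK !gquot_mulE; apply: (dinj_map1 pl).
exact: gmulA.
Qed.

Lemma gquot_mulC i j (x : gquot_sort i) (y : gquot_sort j) :
  dinj (gquot_mul x y) = ksign (i * j) *: dinj (gquot_mul y x).
Proof.
by rewrite -[x]topiK -[y]topiK !gquot_mulE; apply: (dinj_map pl); apply: gmulC.
Qed.

Definition gquot : galg := GAlg gquot_mul_bilin gquot_mul1 gquot_mulA gquot_mulC.
End Quotient.

(* Local graded algebras with residue field [K]: [lmax] is the largest
   proper ideal, and [K -> A / lmax] is onto (it is injective because [lmax]
   is proper). *)
Record glocal := GLocal {
  lalg :> galg;
  lmax : gideal lalg;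
  lmax_proper : ~ lmax 0 (gone lalg);
  lmax_max : forall J : gideal lalg, ~ J 0 (gone lalg) ->
    forall i (x : lalg i), J i x -> lmax i x;
  lres0 : forall x : lalg 0, exists c : K, lmax 0 (x - c *: gone lalg);
  lres : forall i (x : lalg i), i != 0 -> lmax i x }.

(* [gprod m n x]: [x] is a product of [n] homogeneous elements of [m] *)
Inductive gprod (A : galg) (m : gideal A) : nat -> forall i, A i -> Prop :=
| GProd0 : gprod m 0 (gone A)
| GProdS n i j (x : A i) (y : A j) :
    m i x -> gprod m n y -> gprod m n.+1 (gmul x y).

Definition gnilpotent (A : galg) (m : gideal A) : Prop :=
  exists N : nat, forall i (x : A i), gprod m N x -> x = 0.

Definition gartinian (A : galg) : Prop :=
  forall I : nat -> gideal A,
    (forall n i (x : A i), I n.+1 i x -> I n i x) ->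
    exists N : nat, forall n, (N <= n)%N -> forall i (x : A i), I N i x -> I n i x.

(* Chains are taken among homogeneous ideals. Nilpotency of the maximal ideal
   follows from the chain condition; it is recorded for convenience. *)
Record gart := GArt {
  aloc :> glocal;
  art_artinian : gartinian aloc;
  art_nilpotent : gnilpotent (lmax aloc) }.

(* morphisms of graded local algebras *)
Record lhom (A B : glocal) := LHom {
  lfun :> ghom A B;
  lfun_local : forall i (x : A i), lmax A i x -> lmax B i (lfun i x) }.

Lemma lhom_eq (A B : glocal) (f g : lhom A B) : (forall i (x : A i), f i x = g i x) -> f = g.
Proof.
case: f g => [[f f1 f2 f3] f4] [[g g1 g2 g3] g4] /= fg.
have E : f = g.
  by apply: functional_extensionality_dep => i; apply: functional_extensionality_dep => x.
subst g.
by rewrite (Prop_irrelevance f1 g1) (Prop_irrelevance f2 g2) (Prop_irrelevance f3 g3)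
  (Prop_irrelevance f4 g4).
Qed.

Section Category.
Variables A B C : glocal.

Fact lid_linear i : linear (fun x : A i => x). Proof. by []. Qed.
Definition ghom_id : ghom A A := @GHom A A (fun i x => x) lid_linear erefl (fun _ _ _ _ => erefl).
Definition lhom_id : lhom A A := @LHom A A ghom_id (fun _ _ => id).

Variables (g : lhom B C) (f : lhom A B).
Definition comp_fun i (x : A i) : C i := g i (f i x).
Fact comp_linear i : linear (@comp_fun i).
Proof. by move=> a x y; rewrite /comp_fun (gfun_linear f) (gfun_linear g). Qed.
Fact comp1 : comp_fun (gone A) = gone C.
Proof. by rewrite /comp_fun gfun1 gfun1. Qed.
Fact compM i j (x : A i) (y : A j) : comp_fun (gmul x y) = gmul (comp_fun x) (comp_fun y).
Proof. by rewrite /comp_fun gfunM gfunM. Qed.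
Fact comp_local i (x : A i) : lmax A i x -> lmax C i (comp_fun x).
Proof. by move=> mx; do 2 apply: lfun_local. Qed.
Definition lhom_comp : lhom A C := @LHom A C (GHom comp_linear comp1 compM) comp_local.
End Category.

Record gfunctor := GFunctor {
  Fobj :> gart -> Type;
  Fmap : forall A B : gart, lhom A B -> Fobj A -> Fobj B;
  Fmap_id : forall A (x : Fobj A), Fmap (lhom_id A) x = x;
  Fmap_comp : forall (A B C : gart) (g : lhom B C) (f : lhom A B) (x : Fobj A),
    Fmap (lhom_comp g f) x = Fmap g (Fmap f x) }.

Definition functor_iso (F G : gfunctor) : Prop :=
  exists eta : forall A : gart, F A -> G A,
    (forall A, bijective (eta A)) /\
    (forall (A B : gart) (f : lhom A B) (x : F A),
       eta B (Fmap f x) = Fmap f (eta A x)).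

Fact lhom_comp_id (R A : glocal) (x : lhom R A) : lhom_comp (lhom_id A) x = x.
Proof. exact: lhom_eq. Qed.
Fact lhom_compA (R A B C : glocal) (g : lhom B C) (f : lhom A B) (x : lhom R A) :
  lhom_comp (lhom_comp g f) x = lhom_comp g (lhom_comp f x).
Proof. exact: lhom_eq. Qed.

Definition hfunctor (R : glocal) : gfunctor :=
  @GFunctor (fun A => lhom R A) (fun A B f h => lhom_comp f h)
    (fun A => @lhom_comp_id R A) (fun A B C => @lhom_compA R A B C).

End GradedAlgebras.

Section Monomials.
Variables (n : nat) (d : 'I_n -> int).

Definition mono := {ffun 'I_n -> nat}.
Implicit Types a b c : mono.

Definition madd a b : mono := [ffun i => (a i + b i)%N].
Definition msub a b : mono := [ffun i => (a i - b i)%N].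
Definition mone : mono := [ffun=> 0%N].
Definition mle a b := [forall i, a i <= b i]%N.

Definition mdeg a : int := \sum_(i < n) (a i)%:Z * d i.

(* variables of odd degree square to zero *)
Definition mvalid a := [forall i, odd `|d i|%N ==> (a i <= 1)%N].

(* [t^a * t^b = (-1)^(mexch a b) t^(a+b)]: each t_j occurring in [t^b] is moved
   to the left past the t_i with i > j occurring in [t^a]. *)
Definition mexch a b : int :=
  \sum_(i < n) \sum_(j < n | (j < i)%N) ((a i)%:Z * d i) * ((b j)%:Z * d j).

Definition mdivs c : seq mono :=
  [seq [ffun i => nat_of_ord (f i)] | f : {dffun forall i : 'I_n, 'I_(c i).+1}].

Lemma mleP a b : reflect (forall i, (a i <= b i)%N) (mle a b).
Proof. exact: forallP. Qed.

Lemma mem_mdivs c a : (a \in mdivs c) = mle a c.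
Proof.
apply/idP/mleP => [/mapP[f _ ->] i|ac]; first by rewrite ffunE -ltnS ltn_ord.
apply/mapP; exists [ffun i => Ordinal (ac i : a i < (c i).+1)%N]; rewrite ?mem_enum //.
by apply/ffunP => i; rewrite !ffunE.
Qed.

Lemma mdivs_uniq c : uniq (mdivs c).
Proof.
rewrite map_inj_uniq ?enum_uniq // => f g /ffunP fg; apply/ffunP => i.
by apply: val_inj; have := fg i; rewrite !ffunE.
Qed.

Lemma maddC a b : madd a b = madd b a.
Proof. by apply/ffunP => i; rewrite !ffunE addnC. Qed.
Lemma maddA a b c : madd a (madd b c) = madd (madd a b) c.
Proof. by apply/ffunP => i; rewrite !ffunE addnA. Qed.
Lemma madd1 a : madd mone a = a.
Proof. by apply/ffunP => i; rewrite !ffunE. Qed.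
Lemma maddK a b : msub (madd a b) a = b.
Proof. by apply/ffunP => i; rewrite !ffunE addKn. Qed.
Lemma msubK a b : mle a b -> madd a (msub b a) = b.
Proof. by move=> /mleP ab; apply/ffunP => i; rewrite !ffunE subnKC. Qed.
Lemma mle_addr a b : mle a (madd a b).
Proof. by apply/mleP => i; rewrite !ffunE leq_addr. Qed.
Lemma mle_sub a b : mle (msub a b) a.
Proof. by apply/mleP => i; rewrite !ffunE leq_subr. Qed.
Lemma mle_trans a b c : mle a b -> mle b c -> mle a c.
Proof. by move=> /mleP ab /mleP bc; apply/mleP => i; apply: leq_trans (ab i) (bc i). Qed.
Lemma mle1 a : mle mone a.
Proof. by apply/mleP => i; rewrite ffunE. Qed.
Lemma msub1 a : msub a mone = a.
Proof. by apply/ffunP => i; rewrite !ffunE subn0. Qed.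
Lemma mle_sub2 a b c : mle a (msub c b) -> mle b c -> mle (madd b a) c.
Proof.
move=> /mleP h /mleP bc; apply/mleP => i; have := h i; rewrite !ffunE.
by rewrite leq_subRL.
Qed.
Lemma msubA a b c : msub (msub c a) b = msub c (madd a b).
Proof. by apply/ffunP => i; rewrite !ffunE subnDA. Qed.

Lemma mdegD a b : mdeg (madd a b) = mdeg a + mdeg b.
Proof.
by rewrite -big_split; apply: eq_bigr => i _; rewrite ffunE PoszD mulrDl.
Qed.
Lemma mdeg1 : mdeg mone = 0.
Proof. by rewrite /mdeg big1 // => i _; rewrite ffunE mul0r. Qed.

Lemma mvalid1 : mvalid mone.
Proof. by apply/forallP => i; rewrite ffunE implybT. Qed.
Lemma mvalid_le a b : mle a b -> mvalid b -> mvalid a.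
Proof.
move=> /mleP ab /forallP vb; apply/forallP => i; apply/implyP => od.
by apply: leq_trans (ab i) _; apply: (implyP (vb i)).
Qed.

Lemma mexchDl a b c : mexch (madd a b) c = mexch a c + mexch b c.
Proof.
rewrite -big_split; apply: eq_bigr => i _; rewrite -big_split; apply: eq_bigr => j _ /=.
by rewrite ffunE PoszD !mulrDl.
Qed.
Lemma mexchDr a b c : mexch a (madd b c) = mexch a b + mexch a c.
Proof.
rewrite -big_split; apply: eq_bigr => i _; rewrite -big_split; apply: eq_bigr => j _ /=.
by rewrite ffunE PoszD !mulrDl mulrDr.
Qed.
Lemma mexch1 a : mexch mone a = 0.
Proof. by rewrite /mexch big1 // => i _; rewrite big1 // => j _; rewrite ffunE !mul0r. Qed.

Lemma mexchC a b : mexch a b + mexch b a + \sum_(i < n) ((a i)%:Z * d i) * ((b i)%:Z * d i)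
  = mdeg a * mdeg b.
Proof.
rewrite /mdeg mulr_suml; under [RHS]eq_bigr do rewrite mulr_sumr.
have -> : mexch b a = \sum_(i < n) \sum_(j < n | (i < j)%N) ((a i)%:Z * d i) * ((b j)%:Z * d j).
  rewrite /mexch (exchange_big_dep xpredT) //=.
  by apply: eq_bigr => i _; apply: eq_bigr => j _; rewrite mulrC.
rewrite -!big_split; apply: eq_bigr => i _ /=.
rewrite [RHS](bigD1 i) //= addrC; congr (_ + _).
rewrite [RHS](bigID (fun j : 'I_n => (j < i)%N)) /=; congr (_ + _); apply: eq_bigl => j.
  by rewrite -val_eqE /= -?(inj_eq val_inj) neq_ltn; case: (ltngtP j i).
by rewrite -(inj_eq val_inj) /= neq_ltn; case: (ltngtP j i).
Qed.
End Monomials.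

Section Signs.
Variable K : fieldType.

Lemma ksignD (i j : int) : ksign K (i + j) = ksign K i * ksign K j.
Proof. by rewrite /ksign expfzDr ?oppr_eq0 ?oner_eq0. Qed.
Lemma ksignM2 (i j : int) : odd `|j|%N = false -> ksign K (i * j) = 1.
Proof.
move=> oj; rewrite /ksign mulrC -exprz_exp.
suff -> : (-1 : K) ^ j = 1 by rewrite exp1rz.
case: j oj => m /= oj; first by rewrite -exprnP -signr_odd oj.
by rewrite NegzE -exprnN -signr_odd; move: oj; rewrite /= => ->; rewrite expr0 invr1.
Qed.
Lemma ksign_sum (J : Type) (r : seq J) (F : J -> int) :
  (forall j, ksign K (F j) = 1) -> ksign K (\sum_(j <- r) F j) = 1.
Proof.
move=> h; apply: (big_ind (fun x => ksign K x = 1)) => // x y hx hy.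
by rewrite ksignD hx hy mulr1.
Qed.
Lemma ksignK (i : int) : ksign K i * ksign K i = 1.
Proof. by rewrite -ksignD -mulr2n -mulr_natr ksignM2. Qed.

Lemma ksign_exch n (d : 'I_n -> int) (a b : mono n) : mvalid d (madd a b) ->
  ksign K (mexch d a b) = ksign K (mdeg d a * mdeg d b) * ksign K (mexch d b a).
Proof.
move=> /forallP v; rewrite -mexchC !ksignD [RHS]mulrAC.
rewrite -(mulrA _ (ksign K (mexch d b a)) (ksign K (mexch d b a))) ksignK mulr1.
rewrite -[LHS]mulr1; congr (_ * _); apply/esym/ksign_sum => i.
have [od|/negbTE ev] := boolP (odd `|d i|%N); last by rewrite mulrA ksignM2.
have := implyP (v i) od; rewrite ffunE.
by case: (a i) (b i) => [|x] [|y] //=; rewrite ?mul0r ?mulr0 //= addnS addSn.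
Qed.
End Signs.

Section PowerSeries.
Variables (K : fieldType) (n : nat) (d : 'I_n -> int).

Implicit Types (f g h : mono n -> K^o) (c : mono n).

Definition ps_mul_fun f g : mono n -> K^o := fun c =>
  if mvalid d c then
    \sum_(a <- mdivs c) ksign K (mexch d a (msub c a)) * f a * g (msub c a)
  else 0.

(* The degree [i] part consists of the series in the monomials of degree [i]
   (an infinite product of lines if there are infinitely many of them). *)
Definition ps_supp (i : int) : set (mono n -> K^o) :=
  [set f | forall c, f c != 0 -> mvalid d c && (mdeg d c == i)].

Fact ps_supp0 i : ps_supp i 0.
Proof. by move=> c; rewrite eqxx. Qed.
Fact ps_suppP i a f g : ps_supp i f -> ps_supp i g -> ps_supp i (a *: f + g).
Proof.
move=> hf hg c; have [fc0|fc] := eqVneq (f c) 0; last by move=> _; exact: hf.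
have -> : (a *: f + g) c = a *: f c + g c by [].
by rewrite fc0 scaler0 add0r; apply: hg.
Qed.
Definition ps_sub i : subspace (mono n -> K^o) := Subspace (ps_supp0 i) (@ps_suppP i).

Definition ps (i : int) : lmodType K := submod (ps_sub i).
Definition pscoef i (f : ps i) : mono n -> K^o := val f.

Fact ps_one_supp : ps_sub 0 (fun c => (c == mone n)%:R).
Proof.
move=> c; have [-> _|] := eqVneq c (mone n); last by rewrite eqxx.
by rewrite mvalid1 mdeg1 eqxx.
Qed.
Definition ps_one : ps 0 := to_submod ps_one_supp.

Fact ps_mul_supp i j (f : ps i) (g : ps j) : ps_sub (i + j) (ps_mul_fun (pscoef f) (pscoef g)).
Proof.
move=> c; rewrite /ps_mul_fun; case: ifP => [v|_]; last by rewrite eqxx.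
apply: contraR => degc; apply/eqP; rewrite big_seq big1 // => a.
rewrite mem_mdivs => ac; apply/eqP; apply: contraR degc.
rewrite !mulf_eq0 !negb_or -andbA => /and3P[_ fa ga].
have /andP[_ /eqP di] := submodP f _ fa; have /andP[_ /eqP dj] := submodP g _ ga.
by rewrite -(msubK ac) mdegD di dj eqxx.
Qed.
Definition ps_mul i j (f : ps i) (g : ps j) : ps (i + j) := to_submod (@ps_mul_supp i j f g).

Lemma ps_mulE i j (f : ps i) (g : ps j) :
  pscoef (ps_mul f g) = ps_mul_fun (pscoef f) (pscoef g).
Proof. by []. Qed.

Lemma ps_mul_bilin i j : bilin (@ps_mul i j).
Proof.
split=> [g a f f'|f a g g'] /=; apply: val_inj; apply: funext => c /=.
  have E u v w : (a *: u + v) w = a *: u w + v w :> K^o by [].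
  rewrite E /ps_mul_fun /=; case: ifP => _; last by rewrite scaler0 addr0.
  rewrite scaler_sumr -big_split /=; apply: eq_bigr => b _.
  by rewrite /pscoef /= E mulrDr mulrDl /GRing.scale /= !mulrA (mulrC a).
have E u v w : (a *: u + v) w = a *: u w + v w :> K^o by [].
rewrite E /ps_mul_fun /=; case: ifP => _; last by rewrite scaler0 addr0.
rewrite scaler_sumr -big_split /=; apply: eq_bigr => b _.
by rewrite /pscoef /= E mulrDr /GRing.scale /= !mulrA (mulrC _ a) !mulrA.
Qed.

Lemma ps_dinj_eq i j (f : ps i) (g : ps j) : i = j ->
  (forall c, pscoef f c = pscoef g c) -> dinj f = dinj g :> dsum ps.
Proof.
move=> ij; case: _ / ij g => g fg; congr dinj; apply: val_inj; exact: funext.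
Qed.

Lemma ps_mul1 i (f : ps i) : dinj (ps_mul ps_one f) = dinj f.
Proof.
apply: ps_dinj_eq; first by rewrite add0r.
move=> c; rewrite /pscoef /= /ps_mul_fun.
case: ifP => v; last first.
  apply/esym/eqP; apply: contraFT v => fc; have /andP[] := submodP f _ fc.
  by [].
rewrite (bigD1_seq (mone n)) ?mdivs_uniq ?mem_mdivs ?mle1 //= big1 => [|a /negbTE na].
  by rewrite addr0 /pscoef /= eqxx mulr1 mexch1 msub1 mul1r.
by rewrite /pscoef /= na mulr0 mul0r.
Qed.

Lemma mdivs_exchange (c : mono n) (F : mono n -> mono n -> K) :
  \sum_(e <- mdivs c) \sum_(a <- mdivs e) F a e =
  \sum_(a <- mdivs c) \sum_(b <- mdivs (msub c a)) F a (madd a b).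
Proof.
have divE e : mle e c -> \sum_(a <- mdivs e) F a e = \sum_(a <- mdivs c | mle a e) F a e.
  move=> ec; rewrite -[RHS]big_filter; apply: perm_big; apply: uniq_perm.
  - exact: mdivs_uniq.
  - by rewrite filter_uniq ?mdivs_uniq.
  - move=> a; rewrite mem_filter !mem_mdivs; case: (boolP (mle a e)) => //= ae.
    by rewrite (mle_trans ae ec).
rewrite big_seq; under eq_bigr => e ec do rewrite divE -?mem_mdivs //.
rewrite -big_seq (exchange_big_dep xpredT) //= big_seq [RHS]big_seq.
apply: eq_bigr => a; rewrite mem_mdivs => ac.
rewrite -[LHS]big_filter -(big_map (madd a) xpredT (fun e => F a e)).
apply: perm_big; apply: uniq_perm.
- by rewrite filter_uniq ?mdivs_uniq.
- by rewrite map_inj_uniq ?mdivs_uniq // => x y xy; rewrite -(maddK a x) xy maddK.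
move=> e; rewrite mem_filter mem_mdivs; apply/andP/mapP => [[ae ec]|[b bm ->]].
  exists (msub e a); last by rewrite msubK.
  rewrite mem_mdivs; apply/mleP => i; rewrite !ffunE leq_sub2r //.
  exact: (mleP _ _ ec).
by rewrite mem_mdivs in bm; rewrite mle_addr mle_sub2.
Qed.

Lemma ps_mulA i j k (f : ps i) (g : ps j) (h : ps k) :
  dinj (ps_mul f (ps_mul g h)) = dinj (ps_mul (ps_mul f g) h).
Proof.
apply: ps_dinj_eq; first by rewrite addrA.
move=> c; change (ps_mul_fun (pscoef f) (pscoef (ps_mul g h)) c =
                  ps_mul_fun (pscoef (ps_mul f g)) (pscoef h) c).
rewrite {1 2}/ps_mul_fun; case: ifP => // v.
pose S a b e := ksign K (mexch d a b + mexch d a e + mexch d b e) *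
  (pscoef f a * pscoef g b * pscoef h e).
transitivity (\sum_(a <- mdivs c) \sum_(b <- mdivs (msub c a)) S a b (msub c (madd a b))).
  rewrite big_seq [RHS]big_seq; apply: eq_bigr => a; rewrite mem_mdivs => ac.
  rewrite ps_mulE /ps_mul_fun (mvalid_le (mle_sub c a) v) mulr_sumr.
  rewrite big_seq [RHS]big_seq; apply: eq_bigr => b; rewrite mem_mdivs => bc.
  rewrite msubA -{1}(msubK bc) mexchDr msubA /S !ksignD.
  set s1 := ksign K _; set s2 := ksign K _; set s3 := ksign K _.
  by rewrite -!mulrA; congr (_ * (_ * _)); rewrite mulrCA.
transitivity (\sum_(e <- mdivs c) \sum_(a <- mdivs e) S a (msub e a) (msub c e)).
  rewrite (mdivs_exchange c (fun a e => S a (msub e a) (msub c e))).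
  by apply: eq_bigr => a _; apply: eq_bigr => b _; rewrite maddK.
rewrite big_seq [RHS]big_seq; apply: eq_bigr => e; rewrite mem_mdivs => ec.
rewrite ps_mulE /ps_mul_fun (mvalid_le ec v) mulr_sumr mulr_suml.
rewrite big_seq [RHS]big_seq; apply: eq_bigr => a; rewrite mem_mdivs => ae.
rewrite -{3}(msubK ae) mexchDl /S !ksignD.
set s1 := ksign K _; set s2 := ksign K _; set s3 := ksign K _.
by rewrite !mulrA -[s1 * s2 * s3]mulrA (mulrC s1).
Qed.

Lemma ps_mulC i j (f : ps i) (g : ps j) :
  dinj (ps_mul f g) = ksign K (i * j) *: dinj (ps_mul g f).
Proof.
rewrite -(linZ (@dinj_linear _ _ ps _)); apply: ps_dinj_eq; first by rewrite addrC.
move=> c; have -> : pscoef (ksign K (i * j) *: ps_mul g f) c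
    = ksign K (i * j) * ps_mul_fun (pscoef g) (pscoef f) c by [].
rewrite ps_mulE /ps_mul_fun; case: ifP => v; last by rewrite mulr0.
rewrite mulr_sumr.
have P : perm_eq (mdivs c) [seq msub c a | a <- mdivs c].
  apply: uniq_perm; first exact: mdivs_uniq.
    rewrite map_inj_in_uniq ?mdivs_uniq // => a b; rewrite !mem_mdivs.
    move=> /mleP ac /mleP bc /ffunP ab; apply/ffunP => x.
    by have := ab x; rewrite !ffunE => /(congr1 (subn (c x))); rewrite !subKn.
  move=> a; rewrite mem_mdivs; apply/idP/mapP => [ac|[b _ ->]]; last exact: mle_sub.
  exists (msub c a); first by rewrite mem_mdivs mle_sub.
  by apply/ffunP => x; rewrite !ffunE subKn //; exact: (mleP _ _ ac).
rewrite (perm_big _ P) big_map /= big_seq [RHS]big_seq; apply: eq_bigr => b.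
rewrite mem_mdivs => bc; set a := msub c b.
have -> : msub c a = b by rewrite -{1}(msubK bc) maddC maddK.
have [fa0|fa] := eqVneq (pscoef f a) 0; first by rewrite fa0 !(mulr0, mul0r).
have [gb0|gb] := eqVneq (pscoef g b) 0; first by rewrite gb0 !(mulr0, mul0r).
have /andP[_ /eqP di] := submodP f _ fa; have /andP[_ /eqP dj] := submodP g _ gb.
rewrite ksign_exch; last by rewrite maddC msubK.
by rewrite di dj -!mulrA; congr (_ * (_ * _)); rewrite mulrC.
Qed.

Definition psalg : galg K :=
  @GAlg K ps ps_one ps_mul ps_mul_bilin ps_mul1 ps_mulA ps_mulC.
End PowerSeries.

(* [R] is of the form K[[t_0, ..., t_(n-1)]] / I, with t_i of degree [d i] *)
Definition proartin (K : fieldType) (R : galg K) : Prop :=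
  exists (n : nat) (d : 'I_n -> int) (I : gideal (psalg K d)), giso R (gquot I).

Definition prorepresentable (K : fieldType) (F : gfunctor K) : Prop :=
  exists R : glocal K, proartin R /\ functor_iso F (hfunctor R).

Record dgla (K : fieldType) := DGLA {
  lsort :> int -> lmodType K;
  ldiff : forall i, lsort i -> lsort (i + 1);
  lbr : forall i j, lsort i -> lsort j -> lsort (i + j);
  ldiff_linear : forall i, linear (@ldiff i);
  lbr_bilin : forall i j, bilin (@lbr i j);
  ldiffK : forall i (x : lsort i), ldiff (ldiff x) = 0;
  lbrC : forall i j (x : lsort i) (y : lsort j),
    dinj (lbr x y) = - ksign K (i * j) *: dinj (lbr y x);
  ljacobi : forall i j k (x : lsort i) (y : lsort j) (z : lsort k),
    dinj (lbr x (lbr y z)) =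
      dinj (lbr (lbr x y) z) + ksign K (i * j) *: dinj (lbr y (lbr x z));
  lleibniz : forall i j (x : lsort i) (y : lsort j),
    dinj (ldiff (lbr x y)) =
      dinj (lbr (ldiff x) y) + ksign K i *: dinj (lbr x (ldiff y)) }.

Definition labelian (K : fieldType) (L : dgla K) : Prop :=
  forall i j (x : L i) (y : L j), lbr x y = 0.

Section Cohomology.
Variables (K : fieldType) (L : dgla K).

Fact cocycle0 i : ldiff (0 : L i) = 0. Proof. exact: lin0 (@ldiff_linear K L i). Qed.
Fact cocycleP i a (x y : L i) : ldiff x = 0 -> ldiff y = 0 -> ldiff (a *: x + y) = 0.
Proof. by move=> x0 y0; rewrite ldiff_linear x0 y0 scaler0 addr0. Qed.
Definition cocycles i : subspace (L i) :=
  @Subspace _ _ [set x : L i | ldiff x = 0] (@cocycle0 i) (@cocycleP i).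

(* the cocycles of degree [i] in the image of [d : L^(i-1) -> L^i] *)
Definition is_boundary i (x : submod (cocycles i)) : Prop :=
  exists y : L (i - 1), dinj (ldiff y) = dinj (val x).
Fact boundary0 i : is_boundary (0 : submod (cocycles i)).
Proof.
exists 0; rewrite cocycle0 /= (lin0 (@dinj_linear _ _ (lsort L) _)).
by rewrite (lin0 (@dinj_linear _ _ (lsort L) _)).
Qed.
Fact boundaryP i a (x y : submod (cocycles i)) :
  is_boundary x -> is_boundary y -> is_boundary (a *: x + y).
Proof.
move=> [u ux] [v vy]; exists (a *: u + v).
by rewrite ldiff_linear dinj_linear ux vy -dinj_linear.
Qed.
Definition boundaries i : subspace (submod (cocycles i)) :=
  Subspace (@boundary0 i) (@boundaryP i).

Definition cohomology (i : int) : lmodType K := quotmod (boundaries i).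
Definition total_cohomology : lmodType K := dsum cohomology.

End Cohomology.

Section TensorDGLA.
Variables (K : fieldType) (L : dgla K).

Section Algebra.
Variable A : glocal K.

Definition mxm (j : int) : lmodType K := submod (lmax A j).

Definition mxm_mul i j (x : mxm i) (y : mxm j) : mxm (i + j) :=
  to_submod (gid_mull (val x) (submodP y)).

Definition bidegree (k : int) := {p : int * int | p.1 - p.2 == k}.

(* (L (x) m_A)^k, the sum of the L^i (x) m_A^j over i - j = k *)
Definition LM_summand k (p : bidegree k) : lmodType K :=
  tensor (L (val p).1) (mxm (val p).2).
Definition LM (k : int) : lmodType K := dsum (@LM_summand k).

Fact bidegree_diffP k (p : bidegree k) :
  ((val p).1 + 1, (val p).2).1 - ((val p).1 + 1, (val p).2).2 == k + 1.
Proof. by case: p => [[i j] /= /eqP <-]; rewrite addrAC. Qed.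
Definition bidegree_diff k (p : bidegree k) : bidegree (k + 1) :=
  exist _ ((val p).1 + 1, (val p).2) (bidegree_diffP p).

Fact bidegree_addP k l (p : bidegree k) (q : bidegree l) :
  ((val p).1 + (val q).1, (val p).2 + (val q).2).1 -
  ((val p).1 + (val q).1, (val p).2 + (val q).2).2 == k + l.
Proof.
by case: p q => [[i j] /= /eqP <-] [[i' j'] /= /eqP <-]; rewrite opprD addrACA.
Qed.
Definition bidegree_add k l (p : bidegree k) (q : bidegree l) : bidegree (k + l) :=
  exist _ ((val p).1 + (val q).1, (val p).2 + (val q).2) (bidegree_addP p q).

(* the element l (x) a of L^i (x) m_A^j *)
Definition LM_tens k (p : bidegree k) (l : L (val p).1) (a : mxm (val p).2) : LM k :=
  @dinj K _ (@LM_summand k) p (tens l a).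

(* d (l (x) a) = dl (x) a *)
Definition LM_diff k : LM k -> LM (k + 1) :=
  dlift (fun p => tlift (fun l a => @LM_tens _ (bidegree_diff p) (ldiff l) a)).

(* [l1 (x) a1, l2 (x) a2] = (-1)^(deg l2 deg a1) [l1, l2] (x) a1 a2 *)
Definition LM_br k l (x : LM k) (y : LM l) : LM (k + l) :=
  dlift (fun p : bidegree k => tlift (fun l1 a1 =>
    dlift (fun q : bidegree l => tlift (fun l2 a2 =>
      ksign K ((val q).1 * (val p).2) *:
        @LM_tens _ (bidegree_add p q) (lbr l1 l2) (mxm_mul a1 a2))) y)) x.

Definition maurer_cartan (x : LM 1) : Prop := LM_diff x + 2%:R^-1 *: LM_br x x = 0.

(* the operator [a, -] on (L (x) m_A)^1, for [a] of degree 0 *)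
Definition LM_ad (a : LM 0) (b : LM 1) : LM 1 := LM_br a b.

Definition gauge_term (a : LM 0) (b : LM 1) (n : nat) : LM 1 :=
  (n.+1)`!%:R^-1 *: iter n (LM_ad a) (LM_ad a b - LM_diff a).

(* [b' = exp(ad_a) * b]: since [m_A] is nilpotent the series has finitely many
   nonzero terms, and its sum is the eventual value of the partial sums. *)
Definition gauge (a : LM 0) (b b' : LM 1) : Prop :=
  exists N, forall M, (N <= M)%N -> b' = b + \sum_(n < M) gauge_term a b n.

End Algebra.
End TensorDGLA.

Section TensorDGLAFacts.
Variables (K : fieldType) (L : dgla K).

Lemma lin_comb (U V : lmodType K) (f g : U -> V) (a : K) :
  linear f -> linear g -> linear (fun x => a *: f x + g x).
Proof.
move=> fl gl b x y; rewrite fl gl !scalerDr !scalerA (mulrC a b) -!addrA.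
by congr (_ + _); rewrite addrCA.
Qed.

Lemma lin_comp (U V W : lmodType K) (f : U -> V) (g : V -> W) :
  linear f -> linear g -> linear (fun x => g (f x)).
Proof. by move=> fl gl b x y; rewrite fl gl. Qed.

Lemma bilin_lin (U V W : lmodType K) (f : U -> V -> W) (F : W -> W) :
  linear F -> bilin f -> bilin (fun u v => F (f u v)).
Proof.
move=> Fl [f1 f2]; split=> [v a u u'|u a v v'] /=.
  by rewrite (f1 v) Fl.
by rewrite (f2 u) Fl.
Qed.

Lemma scale_linear (V : lmodType K) (c : K) : linear (fun v : V => c *: v).
Proof. by move=> a x y; rewrite scalerDr !scalerA mulrC. Qed.

Section OneAlgebra.
Variable A : glocal K.

Lemma LM_tens_bilin k (p : bidegree k) : bilin (@LM_tens K L A k p).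
Proof.
split=> [w a v v'|v a w w']; rewrite /LM_tens /=.
  by rewrite ((@tens_bilin _ _ _).1 w) dinj_linear.
by rewrite ((@tens_bilin _ _ _).2 v) dinj_linear.
Qed.

Lemma LM_ext (W : lmodType K) k (F G : LM L A k -> W) : linear F -> linear G ->
  (forall p l a, F (@LM_tens K L A k p l a) = G (@LM_tens K L A k p l a)) -> F =1 G.
Proof.
move=> Fl Gl FG; apply: dsum_ext => // p t; move: t; apply: tensor_ext => //.
- exact: lin_comp (@dinj_linear _ _ (@LM_summand K L A k) p) Fl.
- exact: lin_comp (@dinj_linear _ _ (@LM_summand K L A k) p) Gl.
- by move=> l a; apply: FG.
Qed.

Section Lift.
Variables (W : lmodType K) (k : int).
Variable f : forall p : bidegree k, L (val p).1 -> mxm A (val p).2 -> W.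
Hypothesis f_bil : forall p, bilin (@f p).
Let F : LM L A k -> W := dlift (fun p => tlift (@f p)).
Let tl p : linear (tlift (@f p)). Proof. exact: tlift_linear. Qed.

Lemma LM_lift_linear : linear F.
Proof. exact: dlift_linear tl. Qed.
Lemma LM_lift_tens p l a : F (@LM_tens K L A k p l a) = f l a.
Proof. by rewrite /F /LM_tens (dlift_inj tl) tlift_tens. Qed.
End Lift.

Lemma mxm_mul_bilin i j : bilin (@mxm_mul K A i j).
Proof.
split=> [y a x x'|x a y y']; apply: val_inj => /=.
  exact: (@gmul_bilin K A i j).1.
exact: (@gmul_bilin K A i j).2.
Qed.

Lemma LM_diff_bilin k (p : bidegree k) :
  bilin (fun l a => @LM_tens K L A _ (bidegree_diff p) (ldiff l) a).
Proof.
split=> [w a v v'|v a w w'] /=.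
  by rewrite ldiff_linear ((@LM_tens_bilin _ (bidegree_diff p)).1 w).
exact: ((@LM_tens_bilin _ (bidegree_diff p)).2 (ldiff v)).
Qed.

Lemma LM_diff_linear k : linear (@LM_diff K L A k).
Proof. exact: LM_lift_linear (@LM_diff_bilin k). Qed.
Lemma LM_diff_tens k (p : bidegree k) l a :
  LM_diff (@LM_tens K L A k p l a) = @LM_tens K L A _ (bidegree_diff p) (ldiff l) a.
Proof. exact: (LM_lift_tens (@LM_diff_bilin k)). Qed.

Section Bracket.
Variables k l : int.

Let b (p : bidegree k) (l1 : L (val p).1) (a1 : mxm A (val p).2)
      (q : bidegree l) (l2 : L (val q).1) (a2 : mxm A (val q).2) : LM L A (k + l) :=
  ksign K ((val q).1 * (val p).2) *:
    @LM_tens K L A _ (bidegree_add p q) (lbr l1 l2) (mxm_mul a1 a2).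

Let b_bil2 p l1 a1 q : bilin (@b p l1 a1 q).
Proof.
apply: bilin_lin; first exact: scale_linear.
split=> [w c v v'|v c w w'] /=.
  rewrite ((@lbr_bilin K L _ _).2 l1).
  exact: ((@LM_tens_bilin _ (bidegree_add p q)).1 (mxm_mul a1 w)).
rewrite ((@mxm_mul_bilin _ _).2 a1).
exact: ((@LM_tens_bilin _ (bidegree_add p q)).2 (lbr l1 v)).
Qed.

Let b_bil1 p q l2 a2 : bilin (fun l1 a1 => @b p l1 a1 q l2 a2).
Proof.
apply: bilin_lin; first exact: scale_linear.
split=> [w c v v'|v c w w'] /=.
  rewrite ((@lbr_bilin K L _ _).1 l2).
  exact: ((@LM_tens_bilin _ (bidegree_add p q)).1 (mxm_mul w a2)).
rewrite ((@mxm_mul_bilin _ _).1 a2).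
exact: ((@LM_tens_bilin _ (bidegree_add p q)).2 (lbr v l2)).
Qed.

Let B p l1 a1 (y : LM L A l) : LM L A (k + l) :=
  dlift (fun q => tlift (@b p l1 a1 q)) y.

Let B_lin p l1 a1 : linear (@B p l1 a1).
Proof. exact: LM_lift_linear (@b_bil2 p l1 a1). Qed.
Let B_tens p l1 a1 q l2 a2 : @B p l1 a1 (@LM_tens K L A l q l2 a2) = b l1 a1 l2 a2.
Proof. exact: (LM_lift_tens (@b_bil2 p l1 a1)). Qed.

Let B_bil p y : bilin (fun l1 a1 => @B p l1 a1 y).
Proof.
split=> [w c v v'|v c w w'] /=; move: y; apply: LM_ext.
- exact: B_lin.
- apply: lin_comb; exact: B_lin.
- by move=> q l2 a2; rewrite !B_tens; apply: ((@b_bil1 p q l2 a2).1 w).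
- exact: B_lin.
- apply: lin_comb; exact: B_lin.
- by move=> q l2 a2; rewrite !B_tens; apply: ((@b_bil1 p q l2 a2).2 v).
Qed.

Lemma LM_br_linear1 y : linear (fun x : LM L A k => LM_br x y : LM L A (k + l)).
Proof. exact: LM_lift_linear (fun p => @B_bil p y). Qed.

Let br_B p l1 a1 y : LM_br (@LM_tens K L A k p l1 a1) y = B l1 a1 y.
Proof. exact: (LM_lift_tens (fun p => @B_bil p y)). Qed.

Lemma LM_br_linear2 (x : LM L A k) : linear (fun y : LM L A l => LM_br x y).
Proof.
move=> c y y'; move: x; apply: LM_ext.
- exact: LM_br_linear1.
- apply: lin_comb; exact: LM_br_linear1.
- by move=> p l1 a1; rewrite !br_B B_lin.
Qed.

Lemma LM_br_bilin : bilin (fun (x : LM L A k) (y : LM L A l) => LM_br x y).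
Proof. by split=> [y|x]; [exact: LM_br_linear1|exact: LM_br_linear2]. Qed.

Lemma LM_br_tens p l1 a1 q l2 a2 :
  LM_br (@LM_tens K L A k p l1 a1) (@LM_tens K L A l q l2 a2) =
  ksign K ((val q).1 * (val p).2) *:
    @LM_tens K L A _ (bidegree_add p q) (lbr l1 l2) (mxm_mul a1 a2).
Proof. by rewrite br_B B_tens. Qed.
End Bracket.
End OneAlgebra.

Section Map.
Variables (A B : glocal K) (f : lhom A B).

Definition mxm_map j (a : mxm A j) : mxm B j :=
  to_submod (lfun_local f (submodP a)).

Definition LM_map k : LM L A k -> LM L B k :=
  dlift (fun p => tlift (fun l a => @LM_tens K L B k p l (mxm_map a))).

Lemma mxm_map_linear j : linear (@mxm_map j).
Proof. by move=> a x y; apply: val_inj; apply: gfun_linear. Qed.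

Lemma mxm_mapM i j (x : mxm A i) (y : mxm A j) :
  mxm_map (mxm_mul x y) = mxm_mul (mxm_map x) (mxm_map y).
Proof. by apply: val_inj; apply: gfunM. Qed.

Let map_bil k (p : bidegree k) : bilin (fun l a => @LM_tens K L B k p l (mxm_map a)).
Proof.
split=> [w c v v'|v c w w'] /=; first exact: ((@LM_tens_bilin B k p).1 _).
by rewrite mxm_map_linear; apply: ((@LM_tens_bilin B k p).2 v).
Qed.

Lemma LM_map_linear k : linear (@LM_map k).
Proof. exact: LM_lift_linear (@map_bil k). Qed.
Lemma LM_map_tens k p l a :
  LM_map (@LM_tens K L A k p l a) = @LM_tens K L B k p l (mxm_map a).
Proof. exact: (LM_lift_tens (@map_bil k)). Qed.

Lemma LM_map_diff k (x : LM L A k) : LM_map (LM_diff x) = LM_diff (LM_map x).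
Proof.
move: x; apply: LM_ext.
- exact: lin_comp (@LM_diff_linear A k) (@LM_map_linear _).
- exact: lin_comp (@LM_map_linear _) (@LM_diff_linear B k).
- move=> p l a; rewrite LM_map_tens !LM_diff_tens; exact: LM_map_tens.
Qed.

Lemma LM_map_br k l (x : LM L A k) (y : LM L A l) :
  LM_map (LM_br x y) = LM_br (LM_map x) (LM_map y).
Proof.
move: x; apply: LM_ext.
- exact: lin_comp (@LM_br_linear1 A k l y) (@LM_map_linear _).
- exact: lin_comp (@LM_map_linear _) (@LM_br_linear1 B k l (LM_map y)).
move=> p l1 a1; move: y; apply: LM_ext.
- exact: lin_comp (@LM_br_linear2 A k l _) (@LM_map_linear _).
- exact: lin_comp (@LM_map_linear _) (@LM_br_linear2 B k l _).
move=> q l2 a2; rewrite LM_br_tens !LM_map_tens LM_br_tens (linZ (@LM_map_linear _)).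
by congr (_ *: _); rewrite -mxm_mapM; apply: LM_map_tens.
Qed.

Lemma LM_map_mc (x : LM L A 1) : maurer_cartan x -> maurer_cartan (LM_map x).
Proof.
rewrite /maurer_cartan -LM_map_diff -LM_map_br -(linZ (@LM_map_linear _)).
by rewrite -(linD (@LM_map_linear _)) => ->; rewrite (lin0 (@LM_map_linear _)).
Qed.

Lemma LM_map_gauge (a : LM L A 0) (b b' : LM L A 1) : gauge a b b' ->
  gauge (LM_map a) (LM_map b) (LM_map b').
Proof.
move=> [N hN]; exists N => M /hN ->; rewrite (linD (@LM_map_linear _)).
rewrite (lin_sum (@LM_map_linear _)); congr (_ + _); apply: eq_bigr => n _.
rewrite /gauge_term (linZ (@LM_map_linear _)); congr (_ *: _).
elim: (n : nat) => [|m IH] /=.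
  by rewrite (linB (@LM_map_linear _)) /LM_ad -LM_map_diff -LM_map_br.
exact: (etrans (@LM_map_br 0 1 a _) (congr1 (LM_br (LM_map a)) IH)).
Qed.
End Map.

Lemma LM_map_id (A : glocal K) k (x : LM L A k) : LM_map (lhom_id A) x = x.
Proof.
move: x; apply: LM_ext => [|//|p l a]; first exact: LM_map_linear.
by rewrite LM_map_tens; congr LM_tens; apply: val_inj.
Qed.

Lemma LM_map_comp (A B C : glocal K) (g : lhom B C) (f : lhom A B) k (x : LM L A k) :
  LM_map (lhom_comp g f) x = LM_map g (LM_map f x).
Proof.
move: x; apply: LM_ext => [||p l a]; first exact: LM_map_linear.
  exact: lin_comp (@LM_map_linear A B f k) (@LM_map_linear B C g k).
by rewrite !LM_map_tens; congr LM_tens; apply: val_inj.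
Qed.
End TensorDGLAFacts.

(* The gauge action is defined everywhere: the m_A-adic filtration of
   L (x) m_A is finite, so the exponential series has finitely many nonzero terms. *)
Section GaugeTotal.
Variables (K : fieldType) (L : dgla K) (A : gart K).

Let Q n i (a : A i) : Prop := exists j k (u : A j) (c : A k),
  gprod (lmax A) n u /\ dinj a = dinj (gmul u c).

Let Q0 i (a : A i) : Q 0 a.
Proof.
by exists 0, i, (gone A), a; split; [exact: GProd0|rewrite gmul1].
Qed.

Let QS n i j (x : A i) (a : A j) : lmax A i x -> Q n a -> Q n.+1 (gmul x a).
Proof.
move=> mx [j' [k [u [c [un ac]]]]]; exists (i + j'), k, (gmul x u), c.
split; first exact: GProdS.
rewrite -gmulA; pose g k (v : A k) := dinj (gmul x v).
have gl k' : linear (@g k').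
  by move=> b v w; rewrite /g ((@gmul_bilin K A _ _).2 x) dinj_linear.
by rewrite -/(g _ a) -/(g _ (gmul u c)) -!(dlift_inj gl) ac.
Qed.

Let subspace_preim (V W : lmodType K) (F : V -> W) (Fl : linear F) (T : subspace W) :
  exists T' : subspace V, forall v, T' v <-> T (F v).
Proof.
have T0 : T (F 0) by rewrite (lin0 Fl); apply: subspace0.
have TP a x y : T (F x) -> T (F y) -> T (F (a *: x + y)).
  by move=> Tx Ty; rewrite Fl; apply: subspaceP.
by exists (@Subspace _ _ (fun v => T (F v)) T0 TP).
Qed.

Let LM_ind k (T : subspace (LM L A k)) :
  (forall p l a, T (@LM_tens K L A k p l a)) -> forall x, T x.
Proof.
move=> h x; have E : topi T x = 0.
  move: x; apply: LM_ext => [|b x y|p l a]; first exact: topi_linear.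
    by rewrite scaler0 addr0.
  rewrite -(lin0 (@topi_linear _ _ T)); apply/topiP; rewrite subr0; exact: h.
move: E; rewrite -(lin0 (@topi_linear _ _ T)) => /topiP; by rewrite subr0.
Qed.

Let S n k : subspace (LM L A k) := subspace_span
  [set z | exists p l (a : mxm A (val p).2), Q n (val a) /\ z = @LM_tens K L A k p l a].

Let S_br n k l (x : LM L A k) (y : LM L A l) : S n l y -> S n.+1 (k + l) (LM_br x y).
Proof.
move=> Sy; have [T TE] := subspace_preim (@LM_br_linear2 K L A k l x) (S n.+1 (k + l)).
apply/TE/Sy => _ [q [l2 [a2 [Qa2 ->]]]]; apply/TE; move: x {T TE Sy y} => x.
have [T TE] := subspace_preim
  (@LM_br_linear1 K L A k l (@LM_tens K L A l q l2 a2)) (S n.+1 (k + l)).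
apply/TE; move: x; apply: LM_ind => p l1 a1; apply/TE.
rewrite LM_br_tens; apply: subspaceZ; apply: sub_subspace_span.
exists (bidegree_add p q), (lbr l1 l2), (mxm_mul a1 a2); split => //.
exact: (QS (submodP a1) Qa2).
Qed.

Lemma gauge_total (a : LM L A 0) (b : LM L A 1) : exists b', gauge a b b'.
Proof.
have [N hN] := art_nilpotent A.
have SN y : S N 1 y -> y = 0.
  have Z0 : (0 : LM L A 1) = 0 by [].
  have ZP (c : K) (u v : LM L A 1) : u = 0 -> v = 0 -> c *: u + v = 0.
    by move=> -> ->; rewrite scaler0 addr0.
  apply: (_ : forall y, S N 1 y -> Subspace Z0 ZP y) => {}y; apply.
  move=> _ [p [l [c [[j [k [u [w [uN cw]]]]] ->]]]] /=.
  have c0 : c = 0.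
    apply: val_inj => /=; apply: (@dinj_inj _ _ (gsort A)); rewrite cw (hN _ _ uN).
    rewrite (lin0 ((@gmul_bilin K A _ _).1 w)).
    by rewrite !(lin0 (@dinj_linear _ _ (gsort A) _)).
  rewrite c0; exact: (lin0 ((@LM_tens_bilin K L A 1 p).2 l)).
have S0 y : S 0 1 y.
  by apply: LM_ind => p l c; apply: sub_subspace_span; exists p, l, c.
have Siter n y : S n 1 (iter n (LM_ad a) y).
  by elim: n => [|n IH]; [exact: S0|exact: (@S_br n 0 1 a _ IH)].
exists (b + \sum_(n < N) gauge_term a b n), N => M NM.
congr (_ + _); rewrite (big_ord_widen M (gauge_term a b) NM).
rewrite big_mkcond /=; apply: eq_bigr => i _; case: ifPn => //; rewrite -leqNgt => Ni.
rewrite /gauge_term -(subnKC Ni) iterD (SN (iter N _ _)) ?scaler0 //.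
Qed.
End GaugeTotal.

Section Deformations.
Variables (K : fieldType) (L : dgla K).

Definition mc (A : glocal K) := {x : LM L A 1 | `[< maurer_cartan x >]}.
HB.instance Definition _ A := SubType.on (mc A).
HB.instance Definition _ A := Choice.on (mc A).

Definition gauge_step (A : glocal K) (x y : mc A) : Prop :=
  exists a : LM L A 0, gauge a (val x) (val y).

(* Equivalence generated by [x ~ exp(ad_a) * x]. As the exp(a) form a group
   acting on the Maurer-Cartan elements, this is the relation of being in the
   same gauge orbit; using the generated equivalence avoids a proof of the
   Baker-Campbell-Hausdorff formula. *)
Definition gauge_equiv (A : glocal K) (x y : mc A) : bool :=
  `[< clos_refl_sym_trans (mc A) (@gauge_step A) x y >].

Fact gauge_equiv_class A : equiv_class_of (@gauge_equiv A).
Proof.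
split=> [x|x y|y x z].
- by apply/asboolP; apply: rst_refl.
- by apply/asboolP/asboolP => ?; apply: rst_sym.
- move=> /asboolP xy /asboolP yz; apply/asboolP.
  exact: rst_trans xy yz.
Qed.
Canonical gauge_equiv_rel A := EquivRelPack (@gauge_equiv_class A).

Definition Def_obj (A : gart K) := {eq_quot (@gauge_equiv A)}.
HB.instance Definition _ A := EqQuotient.on (Def_obj A).

Definition mc_map (A B : glocal K) (f : lhom A B) (x : mc A) : mc B :=
  exist _ (LM_map f (val x)) (asboolT (LM_map_mc f (asboolW (valP x)))).

Definition Def_map (A B : gart K) (f : lhom A B) (X : Def_obj A) : Def_obj B :=
  \pi_(Def_obj B) (mc_map f (repr X)).

Fact mc_map_equiv (A B : glocal K) (f : lhom A B) (x y : mc A) :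
  gauge_equiv x y -> gauge_equiv (mc_map f x) (mc_map f y).
Proof.
move=> /asboolP xy; apply/asboolP; elim: xy => {x y}.
- move=> x y [a axy]; apply: rst_step; exists (LM_map f a).
  exact: LM_map_gauge.
- by move=> x; apply: rst_refl.
- by move=> x y _ IH; apply: rst_sym.
- by move=> x y z _ IH1 _ IH2; apply: rst_trans IH1 IH2.
Qed.

Fact Def_map_pi (A B : gart K) (f : lhom A B) (x : mc A) :
  Def_map f (\pi_(Def_obj A) x) = \pi_(Def_obj B) (mc_map f x).
Proof.
apply/eqP; rewrite eqmodE; apply: mc_map_equiv.
by rewrite -[gauge_equiv _ _]/((@gauge_equiv_rel A) _ _) -eqmodE reprK.
Qed.

Fact Def_map_id (A : gart K) (X : Def_obj A) : Def_map (lhom_id A) X = X.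
Proof.
rewrite -[X]reprK Def_map_pi; congr (\pi _); apply: val_inj => /=; exact: LM_map_id.
Qed.

Fact Def_map_comp (A B C : gart K) (g : lhom B C) (f : lhom A B) (X : Def_obj A) :
  Def_map (lhom_comp g f) X = Def_map g (Def_map f X).
Proof.
rewrite -[X]reprK (Def_map_pi f) (Def_map_pi g) Def_map_pi.
by congr (\pi _); apply: val_inj; apply: LM_map_comp.
Qed.

Definition DefZ : gfunctor K := GFunctor Def_map_id Def_map_comp.
End Deformations.

(* Main.v *)
Require Import Defs.
From HB Require Import structures.
From mathcomp Require Import all_boot all_order all_algebra.
From mathcomp Require Import all_classical all_reals complex generic_quotient zify.
From Stdlib Require Import Relation_Operators.

(** Since the bracket of [L] vanishes, so does that of [L (x) m_A]. The
    Maurer-Cartan equation becomes [d x = 0], and the gauge action of [a] becomes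
    the translation [b |-> b - d a]; hence [Def_L(A)] is the cohomology
    [H^1(L (x) m_A)].

    Over a field the complex [L] splits: there are finitely many cocycles [z_k],
    of degrees [e_k], whose classes form a basis of the cohomology, together with
    linear forms [p_k] dual to them that vanish on boundaries, such that
    [l - sum_k p_k(l) z_k] is, up to a boundary, a linear function of [d l]
    ([cohomology_splitting]). The splitting comes from a generalized inverse of
    [d] ([linear_generalized_inverse], by Zorn's lemma) and from a homogeneous
    basis of the cohomology ([homogeneous_basis]). Tensoring this identity with
    [m_A] gives, naturally in [A], an isomorphism of [H^1(L (x) m_A)] with the
    product over [k] of the homogeneous parts of [m_A] of degree [e_k - 1]
    ([tensor_cohomology]).

    That product is also the set of morphisms to [A] from the power series algebra
    on variables [t_k] of degree [e_k - 1]. A morphism is determined by the images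
    of the variables ([lhom_eq_vars]): a series is its constant term plus a
    combination of the variables, so two morphisms that agree on the variables
    differ by elements of every power of [m_A], and [m_A] is nilpotent.
    Conversely, any choice of [x_k] in [m_A] extends ([lhom_extension]): by
    nilpotency only finitely many ordered monomials in the [x_k] are nonzero, so
    that series can be evaluated, and the [x_k] obey the sign rule of the [t_k].
    The squares of the odd [x_k] vanish because 2 is invertible in [K].
    So [Def_L] is represented by a power series algebra without relations. *)

Set Implicit Arguments.
Unset Strict Implicit.
Unset Printing Implicit Defensive.

Import Order.TTheory GRing.Theory Num.Theory.
Local Open Scope classical_set_scope.
Local Open Scope ring_scope.

(** * Generalized inverses and homogeneous bases *)

Section GeneralizedInverse.
Variables (K : fieldType) (V W : lmodType K) (f : V -> W).
Hypothesis f_lin : linear f.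

(** Graphs of partially defined [g] with [f (g w) = w] for each [w] in the image of
    [f] where [g] is defined. The empty graph is allowed, so that the union of an
    empty chain is again one of them. *)
Let partial_inverse (G : set (W * V)) : Prop :=
  [/\ forall (a : K) x y, G x -> G y -> G (a *: x + y),
      forall w v v', G (w, v) -> G (w, v') -> v = v' &
      forall u v, G (f u, v) -> f v = f u].

Let adjoin (G : set (W * V)) (q : W * V) : set (W * V) :=
  [set c *: q + x | c in [set: K] & x in G].

Let adjoin_partial_inverse (G : set (W * V)) (w : W) (v : V) :
  partial_inverse G -> G (0, 0) -> (forall v', ~ G (w, v')) ->
  (forall c x u, G x -> c *: w + x.1 = f u -> f (c *: v + x.2) = f u) ->
  partial_inverse (adjoin G (w, v)).
Proof.
move=> [Glin Gfun Ginv] G0 Gw Hinv; split.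
- move=> a _ _ [c _ [x Gx <-]] [c' _ [y Gy <-]].
  exists (a * c + c') => //; exists (a *: x + y); first exact: Glin.
  by rewrite scalerDl scalerDr scalerA -!addrA; congr (_ + _); rewrite addrCA.
- move=> w1 v1 v2 [c _ [[xw xv] Gx [Ew Ev]]] [c' _ [[yw yv] Gy [Ew' Ev']]].
  have Gxy : G (xw - yw, xv - yv).
    have -> : (xw - yw, xv - yv) = (- 1) *: (yw, yv) + (xw, xv).
      by congr pair; rewrite /= scaleN1r [RHS]addrC.
    exact: Glin.
  have E : (c' - c) *: w = xw - yw.
    by rewrite scalerBl -(addrK yw (c' *: w)) Ew' -Ew; rewrite addrC addrA addrA addNr add0r.
  have [cc|cc] := eqVneq c' c.
    move: E Gxy; rewrite cc subrr scale0r => <- Gxy.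
    have /eqP := Gfun _ _ _ Gxy G0; rewrite subr_eq0 => /eqP xyv.
    by rewrite -Ev -Ev' cc xyv.
  case: (Gw ((c' - c)^-1 *: (xv - yv))).
  have -> : (w, (c' - c)^-1 *: (xv - yv)) = (c' - c)^-1 *: (xw - yw, xv - yv) + (0, 0).
    congr pair; rewrite /= addr0 //.
    by rewrite -E scalerA mulVf ?scale1r // subr_eq0.
  exact: Glin.
- by move=> u v1 [c _ [x Gx [Ew Ev]]]; rewrite -Ev; apply: Hinv.
Qed.

(** A graph that is maximal for inclusion is defined everywhere. First it is defined
    on the image of [f], since one may adjoin a pair [(f u, u)]; after that, a
    vector outside the domain lies outside the image, and may be sent to 0. *)
Lemma linear_generalized_inverse :
  exists2 g : W -> V, linear g & forall v, f (g (f v)) = f v.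
Proof.
have [|G [PG Gmax]] := @Zorn_bigcup _ partial_inverse.
  move=> F FP Ftot; split.
  - move=> a x y [X FX Xx] [Y FY Yy]; have [XY|YX] := Ftot _ _ FX FY.
      by exists Y => //; have [Ylin _ _] := FP _ FY; apply: Ylin => //; apply: XY.
    by exists X => //; have [Xlin _ _] := FP _ FX; apply: Xlin => //; apply: YX.
  - move=> w v v' [X FX Xx] [Y FY Yy]; have [XY|YX] := Ftot _ _ FX FY.
      by have [_ Yfun _] := FP _ FY; apply: (Yfun w) => //; apply: XY.
    by have [_ Xfun _] := FP _ FX; apply: (Xfun w) => //; apply: YX.
  - by move=> u v [X FX Xx]; have [_ _ Xinv] := FP _ FX; apply: Xinv.
have [Glin Gfun Ginv] := PG.
have G0 : G (0, 0).
  apply: contrapT => nG0; have Gempty x : ~ G x.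
    by move=> Gx; apply: nG0; have := Glin (-1) _ _ Gx Gx; rewrite scaleN1r addNr.
  apply: (Gmax [set (0, 0)]).
    by split=> [x /Gempty //|/(_ (0, 0) erefl)].
  split=> [a x y -> ->|w v v' [_ ->] [_ ->] //|u v [-> ->]].
    by rewrite scaler0 addr0.
  exact: lin0.
have maximal w v : (forall v', ~ G (w, v')) ->
    (forall c x u, G x -> c *: w + x.1 = f u -> f (c *: v + x.2) = f u) -> False.
  move=> Gw Hinv; apply: (Gmax (adjoin G (w, v))); last exact: adjoin_partial_inverse.
  split=> [x Gx|sub].
    by exists 0 => //; exists x => //; rewrite scale0r add0r.
  apply: (Gw v); apply: sub.
  by exists 1 => //; exists (0, 0) => //; rewrite scale1r addr0.
have Gim u : exists v, G (f u, v).
  apply: contrapT => /forallNP nG; apply: (@maximal (f u) u) => // c x u' Gx E.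
  have Ex : x.1 = f (- c *: u + u') by rewrite f_lin -E scaleNr addKr.
  rewrite f_lin (Ginv (- c *: u + u') x.2); last by rewrite -Ex -surjective_pairing.
  by rewrite f_lin scaleNr addNKr.
have Gtot w : exists v, G (w, v).
  apply: contrapT => /forallNP nG; apply: (@maximal w 0) => // c x u Gx E.
  have [c0|c0] := eqVneq c 0.
    rewrite c0 scale0r add0r (Ginv u) //; move: E; rewrite c0 scale0r add0r => <-.
    by rewrite -surjective_pairing.
  have [v Gv] := Gim u; case: (nG (c^-1 *: (v - x.2))).
  have -> : (w, c^-1 *: (v - x.2)) = c^-1 *: (-1 *: x + (f u, v)) + (0, 0).
    congr pair; rewrite addr0 /=; last by rewrite scaleN1r addrC.
    by rewrite -E scaleN1r addrC addrK scalerA mulVf // scale1r.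
  apply: (Glin _ _ _ _ G0); exact: Glin.
have [g gG] := choice Gtot; exists g => [a x y|v].
  apply: (Gfun (a *: x + y)) => //; exact: (Glin a _ _ (gG x) (gG y)).
exact: Ginv.
Qed.
End GeneralizedInverse.

Section HomogeneousCast.
Variables (K : fieldType) (V : int -> lmodType K).

(** Transport along an equality of degrees, made total: the result is 0 when the
    degrees differ. This is linear in all cases and needs no proof of equality. *)
Definition gcast i j (x : V i) : V j := dcomp (dinj x) j.

Lemma gcast_linear i j : linear (@gcast i j).
Proof. by move=> a x y; rewrite /gcast dinj_linear. Qed.

Lemma gcast_id i (x : V i) : gcast i x = x.
Proof. exact: dcomp_inj. Qed.

Lemma gcast_neq i j (x : V i) : i != j -> gcast j x = 0.
Proof. by move=> /eqP ij; apply: dcomp_inj_neq. Qed.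

Lemma dinj_gcast i j (x : V i) : i = j -> dinj (gcast j x) = dinj x.
Proof. by move=> <-; rewrite gcast_id. Qed.
End HomogeneousCast.
Arguments gcast {K V i} j x.

Lemma gcast_map (K : fieldType) (V W : int -> lmodType K) (f : forall i, V i -> W i) i j
  (x : V i) : (forall i, linear (f i)) -> f j (gcast j x) = gcast j (f i x).
Proof.
move=> fl; have [<-|ij] := eqVneq i j; first by rewrite !gcast_id.
by rewrite !gcast_neq // (lin0 (fl j)).
Qed.

Section BasisExtraction.
Variables (K : fieldType) (V : lmodType K).

Let list_span (s : seq V) : subspace V := subspace_span [set x | x \in s].

Let list_span_mono (s t : seq V) : {subset s <= t} ->
  forall v, list_span s v -> list_span t v.
Proof. by move=> st v vs S tS; apply: vs => x /st; apply: tS. Qed.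

Let span_ind (X : set V) (S : subspace V) : X `<=` S -> forall v, subspace_span X v -> S v.
Proof. by move=> XS v; apply. Qed.

Let finitary (G : set V) v : subspace_span G v ->
  exists2 s : seq V, {in s, forall x, G x} & list_span s v.
Proof.
pose fin := [set v | exists2 s : seq V, {in s, forall x, G x} & list_span s v].
have fin0 : fin 0 by exists [::] => //; apply: subspace0.
have finP a x y : fin x -> fin y -> fin (a *: x + y).
  move=> [s sG sx] [t tG ty]; exists (s ++ t).
    by move=> z; rewrite mem_cat => /orP[/sG|/tG].
  apply: subspaceP; [apply: list_span_mono sx|apply: list_span_mono ty].
    by move=> z zs; rewrite mem_cat zs.
  by move=> z zt; rewrite mem_cat zt orbT.
apply: (@span_ind _ (Subspace fin0 finP)) => x Gx.
exists [:: x] => [z|]; first by rewrite inE => /eqP ->.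
by apply: sub_subspace_span; rewrite /= inE.
Qed.

Let comb (s : seq V) (c : V -> K) : V := \sum_(x <- s) c x *: x.

Let list_span_comb (s : seq V) v : uniq s -> list_span s v -> exists c, v = comb s c.
Proof.
move=> us; have c0 : [set v | exists c, v = comb s c] 0.
  by exists (fun=> 0); rewrite /comb big1 // => x _; rewrite scale0r.
have cP a x y : [set v | exists c, v = comb s c] x ->
    [set v | exists c, v = comb s c] y -> [set v | exists c, v = comb s c] (a *: x + y).
  move=> [c ->] [c' ->]; exists (fun z => a * c z + c' z).
  rewrite /comb scaler_sumr -big_split; apply: eq_bigr => z _.
  by rewrite scalerDl scalerA.
apply: (@span_ind _ (Subspace c0 cP)) => x /= xs; exists (fun z => (z == x)%:R).
rewrite /comb (bigD1_seq x) //= eqxx scale1r big1 ?addr0 // => z /negbTE ->.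
by rewrite scale0r.
Qed.

(** A shortest list of elements of [G] that spans [V] is a basis: if a nontrivial
    combination of its entries vanished, one entry could be dropped. *)
Lemma basis_of_generators (G : set V) : findim V -> (forall v, subspace_span G v) ->
  exists s : seq V, [/\ uniq s, {in s, forall x, G x},
    forall v, exists c : V -> K, v = \sum_(x <- s) c x *: x &
    forall c : V -> K, \sum_(x <- s) c x *: x = 0 -> {in s, forall x, c x = 0}].
Proof.
move=> [n [b bspan]] Gspan.
pose gen m := `[< exists s : seq V, [/\ size s = m, {in s, forall x, G x} &
  forall v, list_span s v] >].
have genP : exists m, gen m.
  have [t tG] := choice (fun i => let: ex_intro2 s sG si := finitary (Gspan (b i)) in
    ex_intro _ s (conj sG si)).
  pose s := flatten [seq t i | i <- enum 'I_n].
  exists (size s); apply/asboolP; exists s; split=> //.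
    by move=> x /flatten_mapP[i _ xt]; apply: (tG i).1.
  move=> v; have [c ->] := bspan v.
  apply: (big_ind (list_span s)) => [|x y|i _]; [exact: subspace0|exact: subspaceD|].
  apply: subspaceZ; apply: list_span_mono (tG i).2 => x xt.
  by apply/flatten_mapP; exists i; rewrite ?mem_enum.
have [m /asboolP[s [sm sG sspan]] mmin] := ex_minnP genP.
have smin t : {subset t <= s} -> (forall v, list_span t v) -> (size s <= size t)%N.
  move=> ts tspan; rewrite sm; apply: mmin; apply/asboolP; exists t; split=> //.
  by move=> x /ts/sG.
have us : uniq s.
  rewrite -[uniq s]negbK -ltn_size_undup -leqNgt; apply: smin => [x|v].
    by rewrite mem_undup.
  by apply: list_span_mono (sspan v) => x; rewrite mem_undup.
exists s; split=> // [v|c c0 x xs]; first exact: list_span_comb.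
apply/eqP; apply: contraT => cx.
have : (size s <= size (rem x s))%N.
  apply: smin => [y|v]; first exact: mem_rem.
  apply: (@span_ind [set y | y \in s]) (sspan v) => y /= ys.
  have [->|yx] := eqVneq y x; last first.
    by apply: sub_subspace_span; rewrite /= mem_rem_uniq // inE yx.
  set t := rem x s; have -> : x = - (c x)^-1 *: \sum_(z <- s | z != x) c z *: z.
    move: c0; rewrite (bigD1_seq x) //= => /eqP; rewrite addr_eq0 => /eqP E.
    by rewrite scaleNr -scalerN -E scalerA mulVf // scale1r.
  apply: (@subspaceZ _ _ (list_span t)); rewrite big_seq_cond.
  apply: (big_ind (list_span t)) => [|u w|z /andP[zs zx]].
  - exact: subspace0.
  - exact: subspaceD.
  - apply: subspaceZ; apply: sub_subspace_span; by rewrite /= mem_rem_uniq // inE zx.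
by rewrite size_rem // leqNgt prednK ?leqnn //; case: (s) xs.
Qed.
End BasisExtraction.

Lemma homogeneous_basis (K : fieldType) (V : int -> lmodType K) : findim (dsum V) ->
  exists (n : nat) (e : 'I_n -> int) (w : forall k, V (e k)) (p : 'I_n -> dsum V -> K),
  [/\ forall k, linear (p k : dsum V -> K^o), forall k l, p k (dinj (w l)) = (k == l)%:R &
      forall v, v = \sum_k p k v *: dinj (w k)].
Proof.
move=> fV; pose G := [set x : dsum V | exists i (v : V i), x = dinj v].
have Gspan v : subspace_span G v.
  move: v; apply: dsum_ind => [|x y|i v]; [exact: subspace0|exact: subspaceD|].
  by apply: sub_subspace_span; exists i, v.
have [s [us sG sgen sfree]] := basis_of_generators fV Gspan.
have [c cE] := choice sgen.
have cuniq (c1 c2 : dsum V -> K) : \sum_(x <- s) c1 x *: x = \sum_(x <- s) c2 x *: x ->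
    {in s, c1 =1 c2}.
  move=> E x xs; apply/eqP; rewrite -subr_eq0; apply/eqP.
  apply: (sfree (fun x => c1 x - c2 x)) xs.
  by under eq_bigr do rewrite scalerBl; rewrite sumrB E subrr.
have /choice[u uE] : forall k : 'I_(size s), exists u : {i & V i}, s`_k = dinj (tagged u).
  by move=> k; have [|i [v ->]] := sG s`_k; [exact: mem_nth|exists (Tagged V v)].
exists (size s), (fun k => tag (u k)), (fun k => tagged (u k)), (fun k v => c v s`_k); split.
- move=> k a x y; have ks : s`_k \in s by apply: mem_nth.
  apply: (cuniq _ (fun z => a * c x z + c y z)) ks.
  rewrite -cE {1}[x]cE {1}[y]cE scaler_sumr -big_split.
  by apply: eq_bigr => z _; rewrite scalerDl scalerA.
- move=> k l; rewrite -uE.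
  have -> : (k == l) = (s`_k == s`_l) by rewrite nth_uniq.
  apply: (cuniq _ (fun x => (x == s`_l)%:R)); last exact: mem_nth.
  rewrite -cE (bigD1_seq s`_l) ?mem_nth //= eqxx scale1r big1 ?addr0 // => x /negbTE ->.
  by rewrite scale0r.
- move=> v; rewrite {1}[v]cE (big_nth 0) big_mkord.
  by apply: eq_bigr => k _; rewrite uE.
Qed.

(** * Splitting of a complex by its cohomology *)

(** Elements of [V i] and [V j] that agree in the total space have the same image in
    [U]; this moves equalities across degrees that are only provably equal. *)
Lemma dinj_congr (K : fieldType) (V : int -> lmodType K) (U : lmodType K)
    (f : forall i, V i -> U) i j (x : V i) (y : V j) :
  (forall i, linear (f i)) -> dinj x = dinj y -> f i x = f j y.
Proof. by move=> fl xy; rewrite -!(dlift_inj fl) xy. Qed.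

Section CohomologySplitting.
Variables (K : fieldType) (L : dgla K).

Let dl i : linear (@ldiff K L i). Proof. exact: ldiff_linear. Qed.

Let dinj_ldiff i j (x : L i) (y : L j) :
  dinj x = dinj y -> dinj (ldiff x) = dinj (ldiff y) :> dsum L.
Proof.
apply: (@dinj_congr K L _ (fun i x => dinj (ldiff x))) => k.
exact: lin_comp (@dl k) (@dinj_linear _ _ L _).
Qed.

(** The differential indexed by its target, as in the definition of boundaries. *)
Let diff_into i (u : L (i - 1)) : L i := gcast i (ldiff u).

Let diff_into_linear i : linear (@diff_into i).
Proof. by apply: lin_comp; [exact: dl|exact: gcast_linear]. Qed.

Let sP i := cid2 (linear_generalized_inverse (@diff_into_linear i)).
Let s i : L i -> L (i - 1) := projT1 (sP i).
Let s_linear i : linear (@s i). Proof. by rewrite /s; case: (sP i). Qed.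
Let sK i u : diff_into (s (diff_into u)) = diff_into u :> L i.
Proof. by rewrite /s; case: (sP i) => g gl; apply. Qed.

Let dsd i (u : L i) : dinj (ldiff (s (ldiff u))) = dinj (ldiff u) :> dsum L.
Proof.
have du : ldiff u = diff_into (gcast (i + 1 - 1) u).
  apply: (@dinj_inj _ _ L); rewrite dinj_gcast ?subrK //.
  by apply: dinj_ldiff; rewrite dinj_gcast // addrK.
by rewrite -(dinj_gcast (ldiff (s _)) (subrK 1 (i + 1))) du -[in LHS]/(diff_into _) sK.
Qed.

(** As [d s d = d], the map [1 - s d] is a projection onto the cocycles. *)
Let cocycle_proj i (l : L i) : L i := l - gcast i (s (ldiff l)).

Let cocycle_proj_linear i : linear (@cocycle_proj i).
Proof.
by move=> a x y; rewrite /cocycle_proj dl s_linear gcast_linear scalerBr opprD addrACA.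
Qed.

Let cocycle_projP i (l : L i) : cocycles L i (cocycle_proj l).
Proof.
apply: (@dinj_inj _ _ L); rewrite (linB (@dl i)) (linB (@dinj_linear _ _ L _)).
rewrite (dinj_ldiff (dinj_gcast _ _)) ?addrK // dsd.
by rewrite subrr (lin0 (@dinj_linear _ _ L _)).
Qed.

Let cocycle_proj_id i (l : L i) : ldiff l = 0 -> cocycle_proj l = l.
Proof.
by move=> l0; rewrite /cocycle_proj l0 (lin0 (@s_linear _)) (lin0 (@gcast_linear _ _ _ _)) subr0.
Qed.

Let cl i (l : L i) : cohomology L i :=
  topi (boundaries L i) (to_submod (cocycle_projP l)).

Let cl_linear i : linear (@cl i).
Proof.
move=> a x y; rewrite -topi_linear; congr topi; apply: val_inj.
exact: cocycle_proj_linear.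
Qed.

(** The forms [p_k] are the coordinates of the class of the cocycle [l - s (d l)]. It
    has the same class as [sum_k p_k(l) z_k], so the two differ by a boundary. *)
Lemma cohomology_splitting : findim (total_cohomology L) ->
  exists (n : nat) (e : 'I_n -> int) (z : forall k, L (e k))
    (p : 'I_n -> forall i, L i -> K) (s : forall i, L i -> L (i - 1)),
  [/\ forall k i, linear (p k i : L i -> K^o), forall i, linear (s i),
      forall k, ldiff (z k) = 0, forall k i (l : L i), p k _ (ldiff l) = 0 &
      forall k m, p k _ (z m) = (k == m)%:R] /\
  forall i (l : L i), exists y : L (i - 1),
    l = \sum_k p k i l *: gcast i (z k) + gcast i (s _ (ldiff l)) + gcast i (ldiff y).
Proof.
move=> /homogeneous_basis[n [e [w [c [c_linear cw cE]]]]].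
pose z k := val (repr (w k)) : L (e k).
have dz k : ldiff (z k) = 0 by exact: (submodP (repr (w k))).
exists n, e, z, (fun k i l => c k (dinj (cl l))), s; split; first split=> //.
- move=> k i; apply: lin_comp (@c_linear k).
  exact: lin_comp (@cl_linear i) (@dinj_linear _ _ _ _).
- move=> k i l; suff -> : cl (ldiff l) = 0.
    by rewrite (lin0 (@dinj_linear _ _ (cohomology L) _)) (lin0 (@c_linear k)).
  rewrite -(lin0 (@topi_linear _ _ (boundaries L (i + 1)))); apply/topiP; rewrite subr0.
  exists (gcast (i + 1 - 1) l); rewrite /= cocycle_proj_id ?ldiffK //.
  by apply: dinj_ldiff; rewrite dinj_gcast // addrK.
- move=> k m; rewrite -cw; congr (c k (dinj _)); rewrite -[RHS]topiK.
  by congr topi; apply: val_inj; rewrite /= cocycle_proj_id.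
move=> i l; pose Z j : lmodType K := submod (cocycles L j).
pose b : Z i := \sum_k c k (dinj (cl l)) *: @gcast K Z _ i (repr (w k)).
have : cl l = topi (boundaries L i) b.
  rewrite (lin_sum (@topi_linear _ _ (boundaries L i))).
  transitivity (dcomp (dinj (cl l)) i); first by rewrite dcomp_inj.
  rewrite [in LHS](cE (dinj (cl l))).
  rewrite (lin_sum (@dcompP _ _ (cohomology L) i)); apply: eq_bigr => k _.
  rewrite dcompZ (linZ (@topi_linear _ _ _)); congr (_ *: _); rewrite -/(gcast i _).
  rewrite -[w k in LHS]topiK; apply/esym.
  exact: (gcast_map (V := Z) (f := fun j => topi (boundaries L j)) _ _ (fun j => @topi_linear _ _ _)).
move=> /topiP[y yE]; exists y.
have -> : gcast i (ldiff y) = cocycle_proj l - val b by rewrite /gcast yE dcomp_inj.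
have -> : val b = \sum_k c k (dinj (cl l)) *: gcast i (z k).
  rewrite (lin_sum (f := val)) //; apply: eq_bigr => k _; congr (_ *: _).
  exact: (gcast_map (V := Z) (f := fun j (x : Z j) => val x)).
by rewrite addrC addrA subrK subrK.
Qed.
End CohomologySplitting.

(** * First cohomology of the tensor product *)

Section TensorCohomology.
Variables (K : fieldType) (L : dgla K).

(** The form in which simple tensors are compared below: bidegrees that are equal
    without being convertible arise from [(i - 1) + 1]. *)
Lemma LM_tens_dinj (A : glocal K) k (p q : bidegree k)
    (l : L (val p).1) (l' : L (val q).1) (a : mxm A (val p).2) (a' : mxm A (val q).2) :
  val p = val q -> dinj l = dinj l' -> dinj a = dinj a' -> LM_tens l a = LM_tens l' a'.
Proof.
move=> /val_inj pq; case: _ / pq in l' a' *.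
by move=> /(@dinj_inj _ _ L) -> /(@dinj_inj _ _ (mxm A)) ->.
Qed.

Let tensl_linear (A : glocal K) k (p : bidegree k) (a : mxm A (val p).2) :
  linear (fun l : L (val p).1 => LM_tens l a : LM L A k).
Proof. exact: (@LM_tens_bilin K L A k p).1. Qed.

Let tensr_linear (A : glocal K) k (p : bidegree k) (l : L (val p).1) :
  linear (fun a : mxm A (val p).2 => LM_tens l a : LM L A k).
Proof. exact: (@LM_tens_bilin K L A k p).2. Qed.

Fact bidegree_predP k (p : bidegree (k + 1)) :
  ((val p).1 - 1, (val p).2).1 - ((val p).1 - 1, (val p).2).2 == k.
Proof. by case: p => [[i j] /= /eqP E]; rewrite addrAC E addrK. Qed.
Definition bidegree_pred k (p : bidegree (k + 1)) : bidegree k :=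
  exist _ ((val p).1 - 1, (val p).2) (bidegree_predP p).

Fact bidegree1P (e : int) : (e, e - 1).1 - (e, e - 1).2 == 1.
Proof. by rewrite /= opprB addrC subrK. Qed.
Definition bidegree1 (e : int) : bidegree 1 := exist _ (e, e - 1) (bidegree1P e).

Section Split.
Variables (n : nat) (e : 'I_n -> int) (z : forall k, L (e k)).
Variables (p : 'I_n -> forall i, L i -> K) (s : forall i, L i -> L (i - 1)).
Hypothesis p_linear : forall k i, linear (@p k i : L i -> K^o).
Hypothesis s_linear : forall i, linear (@s i).
Hypothesis dz : forall k, ldiff (z k) = 0.
Hypothesis pd : forall k i (l : L i), p k (ldiff l) = 0.
Hypothesis pz : forall k m, p k (z m) = (k == m)%:R.
Hypothesis split_id : forall i (l : L i), exists y : L (i - 1),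
    l = \sum_k p k l *: gcast i (z k) + gcast i (s (ldiff l)) + gcast i (ldiff y).

Section OneAlgebra.
Variable A : glocal K.

(** [p_k (x) 1]. For [l] of degree other than [e k] the cast of [a] is 0, since [l (x) a]
    has total degree 1. *)
Definition LM_coord (k : 'I_n) : LM L A 1 -> mxm A (e k - 1) :=
  dlift (fun q : bidegree 1 => tlift (fun l a => p k l *: gcast (e k - 1) a)).

Let coord_bil k (q : bidegree 1) :
  bilin (fun (l : L (val q).1) (a : mxm A (val q).2) => p k l *: gcast (e k - 1) a).
Proof.
split=> [a c v v'|l c v v'] /=; first by rewrite p_linear scalerDl scalerA.
by rewrite gcast_linear scalerDr !scalerA mulrC.
Qed.

Lemma LM_coord_linear k : linear (@LM_coord k).
Proof. exact: LM_lift_linear (@coord_bil k). Qed.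

Lemma LM_coord_tens k (q : bidegree 1) (l : L (val q).1) (a : mxm A (val q).2) :
  LM_coord k (LM_tens l a) = p k l *: gcast (e k - 1) a.
Proof. exact: (LM_lift_tens (@coord_bil k)). Qed.

Lemma LM_coord_diff k (y : LM L A 0) : LM_coord k (LM_diff y) = 0.
Proof.
move: y; apply: (@LM_ext K L A _ 0 _ (fun=> 0)) => [|a x y|q l a].
- exact: lin_comp (@LM_diff_linear K L A 0) (@LM_coord_linear k).
- by rewrite scaler0 addr0.
- by rewrite LM_diff_tens LM_coord_tens pd scale0r.
Qed.

Definition LM_of_coord (xs : forall k, mxm A (e k - 1)) : LM L A 1 :=
  \sum_k @LM_tens K L A 1 (bidegree1 (e k)) (z k) (xs k).

Lemma LM_diff_of_coord xs : LM_diff (LM_of_coord xs) = 0.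
Proof.
rewrite (lin_sum (@LM_diff_linear K L A 1)) big1 // => k _.
by rewrite LM_diff_tens dz (lin0 (@tensl_linear A _ _ _)).
Qed.

Lemma LM_of_coordK xs k : LM_coord k (LM_of_coord xs) = xs k.
Proof.
rewrite (lin_sum (@LM_coord_linear k)) (bigD1 k) //= LM_coord_tens pz eqxx scale1r.
rewrite gcast_id big1 ?addr0 // => m mk.
by rewrite LM_coord_tens pz eq_sym (negbTE mk) scale0r.
Qed.

(** The homotopy [s (x) 1]. *)
Let S : LM L A (1 + 1) -> LM L A 1 :=
  dlift (fun q => tlift (fun l a => @LM_tens K L A 1 (bidegree_pred q) (s l) a)).

Let S_bil (q : bidegree (1 + 1)) : bilin (fun (l : L (val q).1) (a : mxm A (val q).2) =>
   @LM_tens K L A 1 (bidegree_pred q) (s l) a).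
Proof.
split=> [a c v v'|l c v v'] /=; last exact: tensr_linear.
by rewrite s_linear; apply: (@tensl_linear A _ (bidegree_pred q)).
Qed.

Let S_linear : linear S. Proof. exact: LM_lift_linear S_bil. Qed.

Let bound0 : exists y : LM L A 0, 0 = LM_diff y :> LM L A 1.
Proof. by exists 0; rewrite (lin0 (@LM_diff_linear K L A 0)). Qed.

Let boundP (a : K) (x y : LM L A 1) : (exists u : LM L A 0, x = LM_diff u) ->
  (exists u : LM L A 0, y = LM_diff u) -> exists u : LM L A 0, a *: x + y = LM_diff u.
Proof. by move=> [u ->] [v ->]; exists (a *: u + v); rewrite (@LM_diff_linear K L A 0). Qed.

Let bound : subspace (LM L A 1) := Subspace bound0 boundP.

(** On simple tensors this is the splitting identity of [L] tensored with [a]. Working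
    modulo the subspace of boundaries avoids choosing the boundary linearly in [l]. *)
Let LM_homotopy (x : LM L A 1) : exists y : LM L A 0,
  x = LM_of_coord (fun k => LM_coord k x) + S (LM_diff x) + LM_diff y.
Proof.
pose H (x : LM L A 1) : LM L A 1 := LM_of_coord (fun k => LM_coord k x) + S (LM_diff x).
have H_linear : linear H.
  move=> a u v; rewrite /H /LM_of_coord (@LM_diff_linear K L A 1) S_linear.
  rewrite scalerDr addrACA; congr (_ + _); rewrite scaler_sumr -big_split.
  apply: eq_bigr => k _ /=; rewrite LM_coord_linear.
  exact: (@tensr_linear A 1 (bidegree1 (e k))).
suff /topiP[y yE] : topi bound x = topi bound (H x).
  by exists y; rewrite -yE addrC subrK.
move: x; apply: LM_ext => [||q l a]; first exact: topi_linear.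
  exact: lin_comp H_linear (@topi_linear _ _ bound).
apply/topiP; have [y yE] := split_id l.
have q1 : (val q).1 - 1 = (val q).2.
  by case: q {l a y yE} => [[i j] /= /eqP <-]; rewrite opprB addrC subrK.
exists (@LM_tens K L A 0 (bidegree_pred (q : bidegree (0 + 1))) y a).
rewrite LM_diff_tens.
have -> : H (LM_tens l a) =
    LM_tens (\sum_k p k l *: gcast (val q).1 (z k) + gcast (val q).1 (s (ldiff l))) a.
  rewrite (linD (@tensl_linear A 1 q a)) (lin_sum (@tensl_linear A 1 q a)).
  congr (_ + _).
    apply: eq_bigr => k _; rewrite LM_coord_tens.
    rewrite (linZ (@tensr_linear A 1 (bidegree1 (e k)) (z k))).
    rewrite (linZ (@tensl_linear A 1 q a)); congr (_ *: _).
    have [ek|ek] := eqVneq (e k) (val q).1.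
      have q2 : (val q).2 = e k - 1 by rewrite ek q1.
      apply: LM_tens_dinj; first by rewrite /= [RHS]surjective_pairing q2 ek.
        by rewrite dinj_gcast.
      by rewrite dinj_gcast.
    rewrite (gcast_neq _ ek) (lin0 (@tensl_linear A 1 q a)) gcast_neq.
      exact: (lin0 (@tensr_linear A 1 (bidegree1 (e k)) (z k))).
    by rewrite -q1; apply: contra ek => /eqP/addIr->.
  rewrite LM_diff_tens [LHS](LM_lift_tens S_bil).
  by apply: LM_tens_dinj; rewrite //= ?addrK -?surjective_pairing // dinj_gcast ?addrK.
rewrite -[LHS](linB (@tensl_linear A 1 q a)) {1}yE addrC addKr.
by apply: LM_tens_dinj; rewrite //= ?subrK -?surjective_pairing // dinj_gcast ?subrK.
Qed.

Lemma LM_cocycle_decomposition (x : LM L A 1) : LM_diff x = 0 ->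
  exists y : LM L A 0, x = LM_of_coord (fun k => LM_coord k x) + LM_diff y.
Proof.
by move=> dx; have [y] := LM_homotopy x; rewrite dx (lin0 S_linear) addr0 => E; exists y.
Qed.
End OneAlgebra.

Lemma LM_coord_map (A B : glocal K) (f : lhom A B) k (x : LM L A 1) :
  LM_coord k (LM_map f x) = mxm_map f (LM_coord k x).
Proof.
move: x; apply: LM_ext => [||q l a].
- exact: lin_comp (@LM_map_linear K L A B f 1) (@LM_coord_linear B k).
- exact: lin_comp (@LM_coord_linear A k) (@mxm_map_linear K A B f _).
- rewrite LM_map_tens !LM_coord_tens (linZ (@mxm_map_linear K A B f _)).
  by congr (_ *: _); rewrite (gcast_map (f := mxm_map f)) //; apply: mxm_map_linear.
Qed.
End Split.

(** The maps [P A k] identify [H^1(L (x) m_A)] with the product of the parts of [m_A] of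
    degrees [d k], naturally in [A]. *)
Lemma tensor_cohomology : findim (total_cohomology L) ->
  exists (n : nat) (d : 'I_n -> int) (P : forall (A : glocal K) k, LM L A 1 -> mxm A (d k)),
  [/\ forall A k, linear (P A k),
      forall A k (y : LM L A 0), P A k (LM_diff y) = 0,
      forall A x, LM_diff x = 0 -> (forall k, P A k x = 0) ->
        exists y : LM L A 0, x = LM_diff y,
      forall A (xs : forall k, mxm A (d k)), exists x : LM L A 1,
        LM_diff x = 0 /\ forall k, P A k x = xs k &
      forall A B (f : lhom A B) k x, P B k (LM_map f x) = mxm_map f (P A k x)].
Proof.
move=> /cohomology_splitting[n [e [z [p [s [[pl sl dz pd pz] split_id]]]]]].
exists n, (fun k => e k - 1), (fun A k => @LM_coord n e p A k); split.
- by move=> A k; apply: LM_coord_linear.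
- by move=> A k y; apply: LM_coord_diff.
- move=> A x dx Px; have [y E] := LM_cocycle_decomposition pl sl split_id dx.
  exists y; rewrite E -[RHS]add0r; congr (_ + _); apply: big1 => k _.
  by rewrite Px; apply: (lin0 (@tensr_linear A 1 (bidegree1 (e k)) (z k))).
- move=> A xs; exists (LM_of_coord z xs); split=> [|k]; first exact: LM_diff_of_coord.
  exact: LM_of_coordK.
- by move=> A B f k x; apply: LM_coord_map.
Qed.
End TensorCohomology.

(** * Graded power series as a local algebra *)

Section LocalPowerSeries.
Variables (K : fieldType) (n : nat) (d : 'I_n -> int).
Implicit Types (a b c : mono n).

Local Notation R := (psalg K d).

Definition msize c : nat := (\sum_i c i)%N.

Lemma msizeD a b : msize (madd a b) = (msize a + msize b)%N.
Proof. by rewrite -big_split; apply: eq_bigr => i _; rewrite ffunE. Qed.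

Lemma msize_eq0 c : (msize c == 0)%N = (c == mone n).
Proof.
rewrite sum_nat_eq0; apply/forallP/eqP => [c0|-> i]; last by rewrite ffunE.
by apply/ffunP => i; rewrite ffunE; apply/eqP/c0.
Qed.

Lemma mle1_eq a : mle a (mone n) -> a = mone n.
Proof. by move=> /mleP a1; apply/ffunP => i; apply/eqP; have := a1 i; rewrite !ffunE leqn0. Qed.

Lemma pscoef_deg i (f : R i) c : pscoef f c != 0 -> i = mdeg d c.
Proof. by move=> /(submodP f)/andP[_ /eqP]. Qed.

Lemma pscoef_valid i (f : R i) c : ~~ mvalid d c -> pscoef f c = 0.
Proof. by move=> v; apply/eqP; apply: contraNT v => /(submodP f)/andP[]. Qed.

Lemma ps_eqP i (f g : R i) : (forall c, pscoef f c = pscoef g c) -> f = g.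
Proof. by move=> fg; apply: val_inj; apply: funext. Qed.

Lemma pscoefM i j (f : R i) (g : R j) c : mvalid d c -> pscoef (gmul f g) c =
  \sum_(a <- mdivs c) ksign K (mexch d a (msub c a)) * pscoef f a * pscoef g (msub c a).
Proof. by move=> v; rewrite [LHS]/(ps_mul_fun _ _ _ _) /ps_mul_fun v. Qed.

Lemma pscoef_one c : pscoef (gone R) c = (c == mone n)%:R.
Proof. by []. Qed.

Lemma pscoefD i (f g : R i) c : pscoef (f + g) c = pscoef f c + pscoef g c.
Proof. by []. Qed.
Lemma pscoefB i (f g : R i) c : pscoef (f - g) c = pscoef f c - pscoef g c.
Proof. by []. Qed.
Lemma pscoefZ i k (f : R i) c : pscoef (k *: f) c = k * pscoef f c.
Proof. by []. Qed.

Lemma pscoef_gcast i j (f : R i) c : i = j -> pscoef (gcast j f) c = pscoef f c.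
Proof. by move=> <-; rewrite gcast_id. Qed.

Lemma mdivs_mone a : a \in mdivs (mone n) -> a = mone n.
Proof. by rewrite mem_mdivs => /mle1_eq. Qed.

Let max_supp i : set (R i) := [set f : R i | pscoef f (mone n) = 0].

Let max0 i : max_supp (0 : R i). Proof. by []. Qed.
Let maxP i (k : K) (f g : R i) : max_supp f -> max_supp g -> max_supp (k *: f + g).
Proof. by rewrite /max_supp /= pscoefD pscoefZ => -> ->; rewrite mulr0 addr0. Qed.

Let max_sub i : subspace (R i) := Subspace (@max0 i) (@maxP i).

Let max_mull i j (f : R i) (g : R j) : max_sub j g -> max_sub (i + j) (gmul f g).
Proof.
move=> /= g0; rewrite /max_supp /= pscoefM ?mvalid1 // big_seq big1 // => a /mdivs_mone ->.
by rewrite msub1 g0 mulr0.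
Qed.

Let max_mulr i j (f : R i) (g : R j) : max_sub i f -> max_sub (i + j) (gmul f g).
Proof.
move=> /= f0; rewrite /max_supp /= pscoefM ?mvalid1 // big_seq big1 // => a /mdivs_mone ->.
by rewrite f0 mulr0 mul0r.
Qed.

Definition psmax : gideal R := @GIdeal K R max_sub max_mull max_mulr.

Lemma psmaxE i (f : R i) : psmax i f <-> pscoef f (mone n) = 0.
Proof. by []. Qed.

Section Inverse.
Variable u : R 0.
Hypothesis u0 : pscoef u (mone n) = 0.

(** The inverse of [1 - u] is the fixed point of [f |-> 1 + u f]. As [u] has no constant
    term, this map contracts: the coefficients of [u f] at size [m] depend only on
    those of [f] at smaller sizes, so the iterates stabilize at each monomial. *)
Let step (f : R 0) : R 0 := gone R + (gmul u f : R 0).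
Let Y m : R 0 := iter m step (gone R).

Let mul_u_local m (f g : mono n -> K^o) (c : mono n) :
  (forall b, (msize b < m)%N -> f b = g b) -> (msize c <= m)%N ->
  ps_mul_fun d (pscoef u) f c = ps_mul_fun d (pscoef u) g c.
Proof.
move=> fg cm; rewrite /ps_mul_fun; case: ifP => // v.
rewrite big_seq [RHS]big_seq; apply: eq_bigr => a; rewrite mem_mdivs => ac.
have [->|a1] := eqVneq a (mone n); first by rewrite u0 !(mulr0, mul0r).
rewrite fg //; apply: leq_trans cm; rewrite -{2}(msubK ac) msizeD.
by rewrite -[X in (X < _)%N]add0n ltn_add2r lt0n msize_eq0.
Qed.

Let Y_succ m c : (msize c < m)%N -> pscoef (Y m.+1) c = pscoef (Y m) c.
Proof.
elim: m c => // m IH c; rewrite ltnS => cm.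
rewrite [Y m.+2]iterS [Y m.+1 in RHS]iterS !pscoefD; congr (_ + _).
exact: (mul_u_local IH).
Qed.

Let Y_stable m c : (msize c < m)%N -> pscoef (Y m) c = pscoef (Y (msize c).+1) c.
Proof.
elim: m => // m IH; rewrite ltnS leq_eqVlt => /orP[/eqP->//|cm].
by rewrite Y_succ // IH.
Qed.

Let y_fun c : K^o := pscoef (Y (msize c).+1) c.

Let y_supp : ps_sub K d 0 y_fun.
Proof. by move=> c /(submodP (Y (msize c).+1)). Qed.

Lemma ps_geometric_series : exists y : R 0, y - (gmul u y : R 0) = gone R.
Proof.
exists (to_submod y_supp); apply/eqP; rewrite subr_eq; apply/eqP/ps_eqP => c.
rewrite pscoefD [LHS]/(y_fun c) /y_fun [Y _]iterS pscoefD; congr (_ + _).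
apply: (@mul_u_local (msize c)) => // b bc.
by rewrite [RHS]/(y_fun b) /y_fun Y_stable.
Qed.
End Inverse.

Lemma ps_unit (x : R 0) : pscoef x (mone n) != 0 -> exists y : R 0, gmul x y = gone R :> R 0.
Proof.
set x0 := pscoef x _ => x0_neq0; pose u : R 0 := gone R - x0^-1 *: x.
have [|y yE] := @ps_geometric_series u.
  by rewrite pscoefB pscoefZ pscoef_one eqxx mulVf ?subrr.
exists (x0^-1 *: y); rewrite (linZ ((@gmul_bilin K R 0 0).2 x)).
rewrite -(linZ ((@gmul_bilin K R 0 0).1 y)) -[RHS]yE /u.
rewrite (linB ((@gmul_bilin K R 0 0).1 y)).
have -> : gmul (gone R) y = y by apply: (@dinj_inj _ _ R); apply: gmul1.
by rewrite opprB addrC subrK.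
Qed.

Fact psmax_proper : ~ psmax 0 (gone R).
Proof. by move/psmaxE; rewrite pscoef_one eqxx => /eqP; rewrite oner_eq0. Qed.

Fact psmax_lres i (x : R i) : i != 0 -> psmax i x.
Proof.
move=> i0; apply/psmaxE/eqP; apply: contraT => /pscoef_deg; rewrite mdeg1 => /eqP.
by rewrite (negbTE i0).
Qed.

(** A series of degree 0 with nonzero constant term is invertible; a series of nonzero
    degree has no constant term. *)
Fact psmax_max (J : gideal R) : ~ J 0 (gone R) -> forall i (x : R i), J i x -> psmax i x.
Proof.
move=> J1 i x; have [i0|/psmax_lres//] := eqVneq i 0; move: x; rewrite i0 => x Jx.
apply/psmaxE/eqP; apply/negP => /negP/ps_unit[y xy]; apply: J1.
by rewrite -xy; apply: (gid_mulr y Jx).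
Qed.

Fact psmax_lres0 (x : R 0) : exists c : K, psmax 0 (x - c *: gone R).
Proof.
exists (pscoef x (mone n)); apply/psmaxE.
by rewrite pscoefB pscoefZ pscoef_one eqxx mulr1 subrr.
Qed.

Definition pslocal : glocal K := GLocal psmax_proper psmax_max psmax_lres0 psmax_lres.

Lemma pslocal_proartin : proartin pslocal.
Proof.
pose zero i : subspace (R i) := @Subspace _ _ [set x | x = 0] erefl
  (fun k x y x0 y0 => etrans (congr2 (fun u v => k *: u + v) x0 y0) (etrans (addr0 _) (scaler0 _ k))).
have zl i j (a : R i) (x : R j) : zero j x -> zero (i + j) (gmul a x).
  by move=> x0; apply: etrans (congr1 (gmul a) x0) (lin0 ((@gmul_bilin K R i j).2 a)).
have zr i j (x : R i) (a : R j) : zero i x -> zero (i + j) (gmul x a).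
  by move=> x0; apply: etrans (congr1 (fun y : R i => gmul y a) x0) (lin0 ((@gmul_bilin K R i j).1 a)).
pose I : gideal R := GIdeal zl zr.
exists n, d, I.
have pi_lin i : linear (@topi K (R i) (I i)) by exact: topi_linear.
have piM i j (x : R i) (y : R j) :
    topi (I (i + j)) (gmul x y) = @gmul _ (gquot I) i j (topi (I i) x) (topi (I j) y).
  by rewrite [RHS]gquot_mulE.
exists (@GHom K R (gquot I) (fun i => topi (I i)) pi_lin erefl piM) => i.
exists repr => x; last exact: topiK.
by apply/eqP; rewrite -subr_eq0; apply/eqP; apply: (repr_topi (I i) x).
Qed.

Definition mvar (k : 'I_n) : mono n := [ffun i => (i == k : nat)].

Lemma mdeg_mvar k : mdeg d (mvar k) = d k.
Proof.
rewrite /mdeg (bigD1 k) //= ffunE eqxx mul1r big1 ?addr0 // => i /negbTE ik.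
by rewrite ffunE ik mul0r.
Qed.

Lemma mvalid_mvar k : mvalid d (mvar k).
Proof. by apply/forallP => i; rewrite ffunE; case: (i == k); rewrite implybT. Qed.

Fact psvar_supp k : ps_sub K d (d k) (fun c => (c == mvar k)%:R).
Proof.
move=> c; have [-> _|] := eqVneq c (mvar k); last by rewrite eqxx.
by rewrite mvalid_mvar mdeg_mvar eqxx.
Qed.
Definition psvar k : R (d k) := to_submod (@psvar_supp k).

Lemma pscoef_psvar k c : pscoef (psvar k) c = (c == mvar k)%:R.
Proof. by []. Qed.

Lemma psvar_max k : psmax (d k) (psvar k).
Proof.
apply/psmaxE; rewrite pscoef_psvar; case: eqVneq => // /ffunP/(_ k).
by rewrite !ffunE eqxx.
Qed.

Lemma mle_mvar k c : mle (mvar k) c = (0 < c k)%N.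
Proof.
apply/mleP/idP => [/(_ k)|ck i]; first by rewrite ffunE eqxx.
by rewrite ffunE; case: eqP => // ->.
Qed.

Lemma psvar_mul k i (g : R i) c : mvalid d c -> pscoef (gmul (psvar k) g) c =
  if (0 < c k)%N then
    ksign K (mexch d (mvar k) (msub c (mvar k))) * pscoef g (msub c (mvar k)) else 0.
Proof.
move=> v; rewrite pscoefM // -mle_mvar; case: ifP => kc.
  rewrite (bigD1_seq (mvar k)) ?mdivs_uniq ?mem_mdivs //= pscoef_psvar eqxx mulr1.
  by rewrite big1 ?addr0 // => a /negbTE ak; rewrite pscoef_psvar ak mulr0 mul0r.
rewrite big_seq big1 // => a; rewrite mem_mdivs pscoef_psvar.
by have [->|_ _] := eqVneq a (mvar k); rewrite ?kc // mulr0 mul0r.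
Qed.

(** The variable [t_k] is the first one that occurs in [t^c]. Moving it to the left of
    [t^c] then costs no sign, and each nonconstant monomial has one such [k]. *)
Definition mfirst (k : 'I_n) c := (0 < c k)%N && [forall j : 'I_n, (j < k)%N ==> (c j == 0)%N].

Lemma mexch_first k c : mfirst k c -> mexch d (mvar k) (msub c (mvar k)) = 0.
Proof.
move=> /andP[_ /forallP cj]; rewrite /mexch big1 // => i _; rewrite big1 // => j ji.
have [ik|ik] := eqVneq i k; last by rewrite ffunE (negbTE ik) !mul0r.
by rewrite ik in ji; rewrite !ffunE (eqP (implyP (cj j) ji)) sub0n mul0r mulr0.
Qed.

Lemma mfirst_uniq k k' c : mfirst k c -> mfirst k' c -> k = k'.
Proof.
move=> /andP[ck /forallP ckj] /andP[ck' /forallP ck'j]; apply: val_inj.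
case: (ltngtP k k') => // kk.
  by have := implyP (ck'j k) kk; rewrite eqn0Ngt ck.
by have := implyP (ckj k') kk; rewrite eqn0Ngt ck'.
Qed.

Lemma mfirst_exists c : c != mone n -> exists k, mfirst k c.
Proof.
move=> c1; have [k0 ck0] : exists k, (0 < c k)%N.
  apply/existsP; apply: contraNT c1 => /existsPn h; apply/eqP/ffunP => i.
  by rewrite ffunE; apply/eqP; have := h i; rewrite lt0n negbK.
case: (arg_minnP (fun k : 'I_n => val k) (P := fun k => (0 < c k)%N) ck0) => k ck kmin.
exists k; rewrite /mfirst ck; apply/forallP => j; apply/implyP => jk.
by rewrite eqn0Ngt; apply/negP => /kmin; rewrite leqNgt jk.
Qed.

Let quot_fun i (g : R i) k : mono n -> K^o := fun b =>
  if mfirst k (madd (mvar k) b) then pscoef g (madd (mvar k) b) else 0.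

Let quot_supp i (g : R i) k : ps_sub K d (i - d k) (quot_fun g k).
Proof.
move=> b; rewrite /quot_fun; case: ifP => _; last by rewrite eqxx.
move=> /(submodP g)/andP[v /eqP <-]; rewrite (mvalid_le _ v) ?mdegD ?mdeg_mvar.
  by rewrite addrAC subrr add0r eqxx.
by rewrite maddC mle_addr.
Qed.

(** The maximal ideal is generated by the variables: [h k] collects the monomials of
    [g] whose first variable is [t_k], divided by [t_k]. *)
Lemma ps_decomposition i (g : R i) : exists h : forall k, R (i - d k),
  g = pscoef g (mone n) *: gcast i (gone R) + \sum_k gcast i (gmul (psvar k) (h k)).
Proof.
exists (fun k => to_submod (@quot_supp i g k)); apply: ps_eqP => c.
rewrite pscoefD pscoefZ.
have -> : pscoef (\sum_k gcast i (gmul (psvar k) (to_submod (@quot_supp i g k)))) c =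
    \sum_k pscoef (gmul (psvar k) (to_submod (@quot_supp i g k))) c.
  rewrite (big_morph (fun f : R i => pscoef f c) (id1 := 0) (op1 := +%R)) //.
  by apply: eq_bigr => k _; rewrite pscoef_gcast // addrC subrK.
have [v|v] := boolP (mvalid d c); last first.
  rewrite (pscoef_valid g v) (pscoef_valid (gcast i _) v) mulr0 add0r big1 // => k _; exact: pscoef_valid.
have sumE : \sum_k pscoef (gmul (psvar k) (to_submod (@quot_supp i g k))) c =
    \sum_(k | mfirst k c) pscoef g c.
  rewrite [RHS]big_mkcond; apply: eq_bigr => k _; rewrite psvar_mul //.
  case: ifP => ck; last by rewrite /mfirst ck.
  rewrite [pscoef (to_submod _) _]/(quot_fun g k _) /quot_fun msubK ?mle_mvar //.
  by case: ifP => fk; [rewrite mexch_first // /ksign expr0z mul1r|rewrite mulr0].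
rewrite sumE; have [->|c1] := eqVneq c (mone n).
  rewrite big_pred0 => [|k]; last by rewrite /mfirst ffunE.
  have [->|/pscoef_deg i0] := eqVneq (pscoef g (mone n)) 0; first by rewrite mul0r addr0.
  by rewrite addr0 pscoef_gcast ?pscoef_one ?eqxx ?mulr1 // i0 mdeg1.
have [k fk] := mfirst_exists c1; rewrite (big_pred1 k) => [|k']; last first.
  by apply/idP/eqP => [/mfirst_uniq/(_ fk)|->].
have -> : pscoef (gcast i (gone R)) c = 0.
  have [i0|i0] := eqVneq 0 i; last by rewrite gcast_neq.
  by rewrite pscoef_gcast // pscoef_one (negbTE c1).
by rewrite mulr0 add0r.
Qed.
End LocalPowerSeries.

(** * Evaluation of power series in an Artin algebra *)

Lemma ksign_odd_sq (K : fieldType) (i : int) : odd `|i|%N -> ksign K (i * i) = -1.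
Proof.
have odd1 j : odd `|j|%N -> (-1 : K) ^ j = -1.
  case: j => m /= oj; first by rewrite -exprnP -signr_odd oj.
  by rewrite NegzE -exprnN -signr_odd; move: oj => /= ->; rewrite expr1 invrN1.
by move=> oi; rewrite /ksign -exprz_exp !odd1.
Qed.

(** Both sides sum [G a b] over the pairs with [a + b <= c]. *)
Lemma mdivs_convolution n (V : nmodType) (c : mono n) (G : mono n -> mono n -> V) :
  \sum_(e <- mdivs c) \sum_(a <- mdivs e) G a (msub e a) =
  \sum_(a <- mdivs c) \sum_(b <- mdivs c | mle (madd a b) c) G a b.
Proof.
have divE e : mle e c -> \sum_(a <- mdivs e) G a (msub e a) =
    \sum_(a <- mdivs c | mle a e) G a (msub e a).
  move=> ec; rewrite -[RHS]big_filter; apply: perm_big; apply: uniq_perm.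
  - exact: mdivs_uniq.
  - by rewrite filter_uniq ?mdivs_uniq.
  - move=> a; rewrite mem_filter !mem_mdivs; case: (boolP (mle a e)) => //= ae.
    by rewrite (mle_trans ae ec).
rewrite big_seq; under eq_bigr => e ec do rewrite divE -?mem_mdivs //.
rewrite -big_seq (exchange_big_dep xpredT) //=; apply: eq_bigr => a _.
rewrite -[LHS]big_filter -[RHS]big_filter.
rewrite -(big_map (fun e => msub e a) xpredT (fun b => G a b)).
apply: perm_big; apply: uniq_perm.
- rewrite map_inj_in_uniq ?filter_uniq ?mdivs_uniq // => x y.
  rewrite !mem_filter => /andP[ax _] /andP[ay _] xy.
  by rewrite -(msubK ax) xy msubK.
- by rewrite filter_uniq ?mdivs_uniq.
move=> b; rewrite mem_filter mem_mdivs; apply/mapP/andP => [[e]|[abc bc]].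
  rewrite mem_filter mem_mdivs => /andP[ae ec] ->; rewrite msubK //; split=> //.
  exact: mle_trans (mle_sub _ _) ec.
by exists (madd a b); rewrite ?maddK // mem_filter mem_mdivs mle_addr.
Qed.

Section TotalAlgebra.
Variables (K : fieldType) (A : galg K).

(** The total space as an associative unital ring. In it the ordered monomials are
    ordinary products, and no identity mentions degrees up to equality. *)
Definition gtot : Type := dsum A.
HB.instance Definition _ := GRing.Lmodule.on gtot.

Let mul_inner (x : gtot) i (a : A i) : gtot :=
  dlift (fun j b => dinj (gmul b a)) x.

Let inner_linear i (a : A i) j : linear (fun b : A j => dinj (gmul b a) : gtot).
Proof. exact: lin_comp ((@gmul_bilin K A j i).1 a) (@dinj_linear _ _ A _). Qed.

Let mul_inner_linear1 i (a : A i) : linear (fun x => mul_inner x a).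
Proof. exact: dlift_linear (inner_linear a). Qed.

Let mul_inner_linear2 (x : gtot) i : linear (@mul_inner x i).
Proof.
move=> c a b; move: x; apply: dsum_ext => [||j x]; first exact: mul_inner_linear1.
  apply: lin_comb; exact: mul_inner_linear1.
rewrite /mul_inner !(dlift_inj (inner_linear _)).
by rewrite ((@gmul_bilin K A j i).2 x) dinj_linear.
Qed.

Definition gtot_mul (x y : gtot) : gtot := dlift (fun i a => mul_inner x a) y.

Let mulr_linear (x : gtot) : linear (gtot_mul x).
Proof. exact: dlift_linear (mul_inner_linear2 x). Qed.

Let mull_linear (y : gtot) : linear (fun x => gtot_mul x y).
Proof.
move=> c x x'; move: y; apply: dsum_ext => [||j y]; first exact: mulr_linear.
  apply: lin_comb; exact: mulr_linear.
by rewrite /gtot_mul !(dlift_inj (mul_inner_linear2 _)) mul_inner_linear1.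
Qed.

Let mul_dinj i j (x : A i) (y : A j) : gtot_mul (dinj x) (dinj y) = dinj (gmul x y).
Proof.
by rewrite /gtot_mul (dlift_inj (mul_inner_linear2 _)) /mul_inner (dlift_inj (inner_linear _)).
Qed.

Let mulA : associative gtot_mul.
Proof.
move=> x y z; move: x; apply: dsum_ext => [||i x]; first exact: mull_linear.
  exact: lin_comp (mull_linear y) (mull_linear z).
move: y; apply: dsum_ext => [||j y].
- exact: lin_comp (mull_linear z) (mulr_linear (dinj x)).
- exact: lin_comp (mulr_linear (dinj x)) (mull_linear z).
move: z; apply: dsum_ext => [||k z].
- exact: lin_comp (mulr_linear (dinj y)) (mulr_linear (dinj x)).
- exact: mulr_linear.
by rewrite !mul_dinj gmulA.
Qed.

Let one : gtot := dinj (gone A).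

Let mul1 : left_id one gtot_mul.
Proof.
move=> x; move: x; apply: dsum_ext => [|//|i x]; first exact: mulr_linear.
by rewrite mul_dinj gmul1.
Qed.

Let mulx1 : right_id one gtot_mul.
Proof.
move=> x; move: x; apply: dsum_ext => [|//|i x]; first exact: mull_linear.
by rewrite mul_dinj gmulC mulr0 /ksign expr0z scale1r gmul1.
Qed.

Let mulDl : left_distributive gtot_mul +%R.
Proof. by move=> x y z; apply: (linD (mull_linear z)). Qed.

Let mulDr : right_distributive gtot_mul +%R.
Proof. by move=> x y z; apply: (linD (mulr_linear x)). Qed.

HB.instance Definition _ := GRing.Zmodule_isPzRing.Build gtot mulA mul1 mulx1 mulDl mulDr.

Lemma gtot_scaleAl (a : K) (x y : gtot) : a *: (x * y) = a *: x * y.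
Proof. by rewrite [RHS](linZ (mull_linear y)). Qed.

Lemma gtot_scaleAr (a : K) (x y : gtot) : a *: (x * y) = x * (a *: y).
Proof. by rewrite [RHS](linZ (mulr_linear x)). Qed.

(** The same function as [dinj], with values declared in the ring [gtot]. *)
Definition hom_elt i (x : A i) : gtot := dinj x.

Lemma hom_elt_linear i : linear (@hom_elt i).
Proof. exact: dinj_linear. Qed.
Lemma hom_elt_inj i : injective (@hom_elt i).
Proof. exact: dinj_inj. Qed.
Lemma hom_elt1 : hom_elt (gone A) = 1.
Proof. by []. Qed.
Lemma hom_eltM i j (x : A i) (y : A j) : hom_elt (gmul x y) = hom_elt x * hom_elt y.
Proof. by rewrite [RHS]mul_dinj. Qed.
Lemma hom_eltC i j (x : A i) (y : A j) :
  hom_elt x * hom_elt y = ksign K (i * j) *: (hom_elt y * hom_elt x).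
Proof. by rewrite -!hom_eltM; apply: gmulC. Qed.

Definition homog (i : int) (t : gtot) : Prop := exists x : A i, t = hom_elt x.

Lemma homog0 i : homog i 0.
Proof. by exists 0; rewrite (lin0 (@hom_elt_linear i)). Qed.
Lemma homogP i c s t : homog i s -> homog i t -> homog i (c *: s + t).
Proof. by move=> [x ->] [y ->]; exists (c *: x + y); rewrite hom_elt_linear. Qed.
Lemma homog_comp i t : homog i t -> hom_elt (dcomp t i) = t.
Proof. by move=> [x ->]; congr hom_elt; apply: dcomp_inj. Qed.
Lemma homog_hom i (x : A i) : homog i (hom_elt x).
Proof. by exists x. Qed.
Lemma homogM i j s t : homog i s -> homog j t -> homog (i + j) (s * t).
Proof. by move=> [x ->] [y ->]; exists (gmul x y); rewrite hom_eltM. Qed.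
Lemma homogC i j s t : homog i s -> homog j t -> s * t = ksign K (i * j) *: (t * s).
Proof. by move=> [x ->] [y ->]; apply: hom_eltC. Qed.
Lemma homog1 : homog 0 1.
Proof. by exists (gone A). Qed.

Lemma homog_exp i t m : homog i t -> homog (m%:Z * i) (t ^+ m).
Proof.
move=> ti; elim: m => [|m IH]; first by rewrite mul0r expr0; apply: homog1.
by rewrite exprS -addn1 PoszD mulrDl mul1r addrC; apply: homogM.
Qed.

Lemma homog_prod n (D : 'I_n -> int) (F : 'I_n -> gtot) :
  (forall k, homog (D k) (F k)) -> homog (\sum_k D k) (\prod_k F k).
Proof.
elim: n D F => [|n IH] D F DF; first by rewrite !big_ord0; apply: homog1.
by rewrite !big_ord_recr; apply: homogM => //; apply: IH.
Qed.

(** The sign is that of moving each [G j] to the left past the [F i] with [j < i]. *)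
Lemma prod_exchange n (D E : 'I_n -> int) (F G : 'I_n -> gtot) :
  (forall k, homog (D k) (F k)) -> (forall k, homog (E k) (G k)) ->
  (\prod_k F k) * (\prod_k G k) =
    ksign K (\sum_(i < n) \sum_(j < n | (j < i)%N) D i * E j) *: \prod_k (F k * G k).
Proof.
elim: n D E F G => [|n IH] D E F G DF EG.
  by rewrite !big_ord0 mulr1 /ksign expr0z scale1r.
rewrite !big_ord_recr /=; set w := widen_ord (leqnSn n).
have DFw k : homog (D (w k)) (F (w k)) by exact: DF.
have EGw k : homog (E (w k)) (G (w k)) by exact: EG.
have -> : \sum_(i < n) \sum_(j < n.+1 | (j < w i)%N) D (w i) * E j =
    \sum_(i < n) \sum_(j < n | (j < i)%N) D (w i) * E (w j).
  apply: eq_bigr => i _; rewrite big_mkcond big_ord_recr /= -big_mkcond /=.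
  by rewrite ltnNge (ltnW (ltn_ord i)) /= addr0.
have -> : \sum_(j < n.+1 | (j < n)%N) D ord_max * E j = D ord_max * \sum_(j < n) E (w j).
  rewrite big_mkcond big_ord_recr /= ltnn addr0 mulr_sumr.
  by apply: eq_bigr => j _; rewrite ltn_ord.
rewrite mulrA -[_ * F ord_max * _]mulrA (homogC (DF ord_max) (homog_prod EGw)).
rewrite -gtot_scaleAr -gtot_scaleAl mulrA (IH _ _ _ _ DFw EGw).
rewrite -!gtot_scaleAl scalerA -ksignD [X in ksign K X]addrC.
by congr (_ *: _); rewrite !mulrA.
Qed.

Lemma prod_eq0 n (F : 'I_n -> gtot) k : F k = 0 -> \prod_k F k = 0.
Proof.
move=> Fk; have : k \in index_enum 'I_n by rewrite mem_index_enum.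
elim: (index_enum 'I_n) => // j r IH; rewrite inE big_cons => /orP[/eqP <-|/IH ->].
  by rewrite Fk mul0r.
by rewrite mulr0.
Qed.

Section Monomials.
Variables (n : nat) (d : 'I_n -> int) (X : 'I_n -> gtot).
Hypothesis Xd : forall k, homog (d k) (X k).

Definition xmon (a : mono n) : gtot := \prod_k X k ^+ a k.

Lemma homog_xmon a : homog (mdeg d a) (xmon a).
Proof. by apply: homog_prod => k; apply: homog_exp. Qed.

Lemma xmon1 : xmon (mone n) = 1.
Proof. by apply: big1 => k _; rewrite ffunE. Qed.

Lemma xmon_var k : xmon (mvar k) = X k.
Proof.
transitivity (\prod_(j | j == k) X j); last exact: big_pred1_eq.
by rewrite [RHS]big_mkcond; apply: eq_bigr => j _; rewrite ffunE; case: (j == k).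
Qed.

Lemma xmonM a b : xmon a * xmon b = ksign K (mexch d a b) *: xmon (madd a b).
Proof.
rewrite (prod_exchange (fun k => homog_exp (a k) (Xd k)) (fun k => homog_exp (b k) (Xd k))).
by congr (_ *: _); apply: eq_bigr => k _; rewrite ffunE exprD.
Qed.

(** An odd [X k] anticommutes with itself, so its square is 0 as 2 is nonzero. *)
Lemma xmon_invalid a : 2%:R != 0 :> K -> ~~ mvalid d a -> xmon a = 0.
Proof.
move=> K2 /forallPn[k]; rewrite negb_imply -ltnNge => /andP[dk ak].
have XX : X k ^+ 2 = 0.
  have := homogC (Xd k) (Xd k); rewrite -expr2.
  rewrite (ksign_odd_sq K dk).
  rewrite scaleN1r => /eqP; rewrite -subr_eq0 opprK -mulr2n -scaler_nat scaler_eq0.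
  by rewrite (negbTE K2) => /eqP.
by apply: (prod_eq0 (k := k)); rewrite -(subnKC ak) exprD XX mul0r.
Qed.
End Monomials.
End TotalAlgebra.

Section Extension.
Variables (K : fieldType) (A : gart K).

(** Products of [m] elements of the maximal ideal, seen in the total ring, where they
    can be multiplied without bookkeeping of degrees. *)
Definition max_power (m : nat) (t : gtot A) : Prop :=
  exists i (x : A i), gprod (lmax A) m x /\ t = hom_elt x.

Lemma max_power0 : max_power 0 1.
Proof. by exists 0, (gone A); split => //; exact: GProd0. Qed.

Lemma max_power1 i (x : A i) : lmax A i x -> max_power 1 (hom_elt x).
Proof.
move=> mx; exists (i + 0), (gmul x (gone A)); split; last by rewrite hom_eltM mulr1.
exact: GProdS mx (GProd0 _).
Qed.

Lemma max_powerD m m' s t : max_power m s -> max_power m' t -> max_power (m + m') (s * t).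
Proof.
move=> [i [x [mx ->]]] [j [y [my ->]]]; elim: mx => {m i x} [|m i j' x x' mx _ IH].
  by exists j, y; split=> //; rewrite hom_elt1 mul1r.
have [k [w [mw E]]] := IH; exists (i + k), (gmul x w); split; first exact: GProdS mw.
by rewrite !hom_eltM -E mulrA.
Qed.

Lemma max_powerX m x : max_power 1 x -> max_power m (x ^+ m).
Proof.
by move=> mx; elim: m => [|m IH]; [exact: max_power0|rewrite exprS; exact: (max_powerD mx IH)].
Qed.

Lemma max_power_prod n (a : 'I_n -> nat) (F : 'I_n -> gtot A) :
  (forall k, max_power (a k) (F k)) -> max_power (\sum_k a k) (\prod_k F k).
Proof.
elim: n a F => [|n IH] a F mF; first by rewrite !big_ord0; apply: max_power0.
by rewrite !big_ord_recr; apply: max_powerD => //; apply: IH.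
Qed.

Lemma max_power_lmax m t : max_power m.+1 t -> forall i, lmax A i (dcomp t i).
Proof.
move=> [j [x [mx ->]]] i; have [<-|/eqP ji] := eqVneq j i; last first.
  by rewrite dcomp_inj_neq //; apply: subspace0.
rewrite dcomp_inj; move: (ltn0Sn m); elim: mx => // m' i' j' x' y mx' _ _ _.
exact: gid_mulr.
Qed.

Lemma max_power_nilpotent : exists N, forall m t, (N <= m)%N -> max_power m t -> t = 0.
Proof.
have [N hN] := art_nilpotent A; exists N => m _ Nm [i [x [mx ->]]].
suff -> : x = 0 by rewrite (lin0 (@hom_elt_linear _ _ _)).
elim: mx Nm => {m i x} [|m i j x y mx my IH].
  by rewrite leqn0 => /eqP N0; apply: hN; rewrite N0; apply: GProd0.
rewrite leq_eqVlt => /orP[/eqP E|/IH ->].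
  by apply: hN; rewrite E; apply: GProdS.
exact: (lin0 ((@gmul_bilin K A i j).2 x)).
Qed.

Variables (n : nat) (d : 'I_n -> int) (x : forall k, A (d k)).
Hypothesis xmax : forall k, lmax A (d k) (x k).
Hypothesis K2 : 2%:R != 0 :> K.

Local Notation R := (psalg K d).
Let X k : gtot A := hom_elt (x k).
Let Xd k : homog (d k) (X k). Proof. exact: homog_hom. Qed.

Let max_power_xmon a : max_power (msize a) (xmon X a).
Proof. by apply: max_power_prod => k; apply: max_powerX; apply: max_power1. Qed.

Let NP := cid max_power_nilpotent.
Let N : nat := projT1 NP.
(** A monomial with an exponent above [N] is a product of more than [N] elements of
    the maximal ideal, so evaluation may be restricted to the divisors of [C]. *)
Let C : mono n := [ffun=> N].

Let xmon_out a : ~~ mle a C -> xmon X a = 0.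
Proof.
move=> /forallPn[k]; rewrite ffunE -ltnNge => ak.
apply: (projT2 NP (msize a)) (max_power_xmon a).
by apply: leq_trans (ltnW ak) _; rewrite /msize (bigD1 k) //= leq_addr.
Qed.

Let F (g : mono n -> K^o) : gtot A := \sum_(a <- mdivs C) (g a : K) *: xmon X a.

Let F_homog i (g : R i) : homog i (F (pscoef g)).
Proof.
apply: (big_ind (homog i)) => [|s t si ti|a _]; first exact: homog0.
  by rewrite -[s]scale1r; apply: homogP.
have [->|/pscoef_deg ia] := eqVneq (pscoef g a) 0; first by rewrite scale0r; apply: homog0.
move: (pscoef g a) => c; rewrite ia -[_ *: _]addr0.
by apply: homogP; [exact: homog_xmon|exact: homog0].
Qed.

Let F_linear i : linear (fun g : R i => F (pscoef g)).
Proof.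
move=> c g h; rewrite /F scaler_sumr -big_split; apply: eq_bigr => a _.
by rewrite pscoefD pscoefZ scalerDl scalerA.
Qed.

Let F1 : F (pscoef (gone R)) = 1.
Proof.
rewrite /F (bigD1_seq (mone n)) ?mdivs_uniq ?mem_mdivs ?mle1 //= pscoef_one eqxx scale1r.
by rewrite xmon1 big1 ?addr0 // => a /negbTE a1; rewrite pscoef_one a1 scale0r.
Qed.

Let F_var k : F (pscoef (psvar K d k)) = X k.
Proof.
have [kC|kC] := boolP (mle (mvar k) C).
  rewrite /F (bigD1_seq (mvar k)) ?mdivs_uniq ?mem_mdivs //= pscoef_psvar eqxx scale1r.
  by rewrite xmon_var big1 ?addr0 // => a /negbTE ak; rewrite pscoef_psvar ak scale0r.
rewrite -xmon_var (xmon_out kC) /F big_seq big1 // => a; rewrite mem_mdivs pscoef_psvar.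
by have [->|_ _] := eqVneq a (mvar k); rewrite ?(negbTE kC) // scale0r.
Qed.

Let F_term i j (g : R i) (h : R j) c : (pscoef (gmul g h) c : K) *: xmon X c =
  \sum_(a <- mdivs c) (pscoef g a * pscoef h (msub c a) : K) *: (xmon X a * xmon X (msub c a)).
Proof.
have E a : a \in mdivs c ->
    xmon X a * xmon X (msub c a) = ksign K (mexch d a (msub c a)) *: xmon X c.
  by rewrite mem_mdivs => ac; rewrite (xmonM Xd) msubK.
have [v|v] := boolP (mvalid d c).
  rewrite pscoefM // scaler_suml big_seq [RHS]big_seq; apply: eq_bigr => a ac.
  by rewrite E // scalerA -mulrA; congr (_ *: _); apply: mulrC.
rewrite (xmon_invalid Xd K2 v) scaler0 big_seq big1 // => a ac.
by rewrite E // (xmon_invalid Xd K2 v) !scaler0.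
Qed.

Let FM i j (g : R i) (h : R j) : F (pscoef (gmul g h)) = F (pscoef g) * F (pscoef h).
Proof.
rewrite {1}/F; under eq_bigr do rewrite F_term.
rewrite (mdivs_convolution C (fun a b => (pscoef g a * pscoef h b : K) *: (xmon X a * xmon X b))).
rewrite /F mulr_suml; apply: eq_bigr => a _; rewrite mulr_sumr big_mkcond.
apply: eq_bigr => b _; rewrite -gtot_scaleAl -gtot_scaleAr scalerA.
by case: ifPn => // abC; rewrite (xmonM Xd) (xmon_out abC) !scaler0.
Qed.

Let f i (g : R i) : A i := dcomp (F (pscoef g)) i.
Let fE i (g : R i) : hom_elt (f g) = F (pscoef g).
Proof. exact: homog_comp (F_homog g). Qed.

Let f_linear i : linear (@f i).
Proof. by move=> c g h; rewrite /f F_linear. Qed.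
Let f1 : f (gone R) = gone A.
Proof. by apply: hom_elt_inj; rewrite fE F1. Qed.
Let fM i j (g : R i) (h : R j) : f (gmul g h) = gmul (f g) (f h).
Proof. by apply: hom_elt_inj; rewrite hom_eltM !fE FM. Qed.

Let f_local i (g : R i) : psmax K d i g -> lmax A i (f g).
Proof.
move=> /psmaxE g0; rewrite /f /F (lin_sum (@dcompP K _ A i)).
apply: (big_ind (lmax A i)) => [|s t|a _]; [exact: subspace0|exact: subspaceD|].
rewrite dcompZ; have [->|a1] := eqVneq a (mone n).
  by rewrite g0 scale0r; apply: subspace0.
apply: subspaceZ; apply: (@max_power_lmax (msize a).-1).
by rewrite prednK ?lt0n ?msize_eq0.
Qed.

(** Evaluation of series at the [x k]. It is multiplicative because [X^a X^b] and
    [X^(a+b)] differ by the sign that occurs in the product of series, and [X^c]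
    vanishes both at the monomials [c] excluded from series and outside [C]. *)
Lemma lhom_extension : exists h : lhom (pslocal K d) A, forall k, h _ (psvar K d k) = x k.
Proof.
pose h : ghom R A := GHom f_linear f1 fM.
exists (@LHom K (pslocal K d) A h f_local) => k.
by apply: hom_elt_inj; rewrite [LHS](fE (psvar K d k)) F_var.
Qed.
End Extension.

(** Write [D] for the difference of the two morphisms. Then [D] kills constants and
    [D (t_k g) = h(t_k) D(g)], so the decomposition of a series by its first variables
    shows that if every product of [m + 1] elements of [m_A] annihilates the values of
    [D], so does every product of [m] elements. This descends from the nilpotency
    exponent to [m = 0]. *)
Lemma lhom_eq_vars (K : fieldType) (n : nat) (d : 'I_n -> int) (A : gart K)
    (h h' : lhom (pslocal K d) A) :
  (forall k, h _ (psvar K d k) = h' _ (psvar K d k)) -> h = h'.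
Proof.
move=> hv; apply: lhom_eq.
have [N hN] := max_power_nilpotent A.
suff key m : forall i (g : psalg K d i) t, max_power (N - m) t ->
    t * hom_elt (h i g - h' i g) = 0.
  move=> i g; apply/eqP; rewrite -subr_eq0; apply/eqP/hom_elt_inj.
  rewrite (lin0 (@hom_elt_linear _ _ _)) -[LHS]mul1r; apply: (key N).
  by rewrite subnn; apply: max_power0.
elim: m => [|m IH] i g t.
  by rewrite subn0 => /hN -> //; rewrite mul0r.
have [mN|Nm] := ltnP m N; last first.
  by have -> : (N - m.+1 = N - m)%N by [lia]; apply: IH.
move=> tm; have [g' gE] := ps_decomposition g.
pose D i (g : psalg K d i) : A i := h i g - h' i g.
have Dlin j : linear (@D j).
  move=> c u v; rewrite /D !gfun_linear scalerBr opprD.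
  by rewrite addrACA.
have D1 : D 0 (gone _) = 0 by rewrite /D !gfun1 subrr.
have Dvar k : hom_elt (D _ (gmul (psvar K d k) (g' k))) =
    hom_elt (h _ (psvar K d k)) * hom_elt (D _ (g' k)).
  by rewrite -hom_eltM /D !gfunM hv -(linB ((@gmul_bilin K A _ _).2 _)).
rewrite -/(D i g) gE (linD (Dlin i)) (linZ (Dlin i)) (gcast_map (f := D)) // D1.
rewrite (lin0 (@gcast_linear _ _ _ _)) scaler0 add0r (lin_sum (Dlin i)).
rewrite (lin_sum (@hom_elt_linear _ _ _)) mulr_sumr big1 // => k _.
rewrite (gcast_map (f := D)) // [hom_elt _]dinj_gcast; last by rewrite addrC subrK.
rewrite -/(hom_elt _) Dvar mulrA; apply: IH.
have -> : (N - m = (N - m.+1) + 1)%N by lia.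
apply: max_powerD => //; apply: max_power1; apply: lfun_local.
exact: psvar_max.
Qed.

(** * Deformations for a vanishing bracket *)

Section AbelianGauge.
Variables (K : fieldType) (L : dgla K).
Hypothesis abel : labelian L.

Lemma LM_br_abelian (A : glocal K) k l (x : LM L A k) (y : LM L A l) : LM_br x y = 0.
Proof.
move: x; apply: (@LM_ext K L A _ k _ (fun=> 0)) => [|c u v|p l1 a1].
- exact: LM_br_linear1.
- by rewrite scaler0 addr0.
move: y; apply: (@LM_ext K L A _ l _ (fun=> 0)) => [|c u v|q l2 a2].
- exact: LM_br_linear2.
- by rewrite scaler0 addr0.
rewrite LM_br_tens abel.
by rewrite (lin0 ((@LM_tens_bilin K L A _ (bidegree_add p q)).1 _)) scaler0.
Qed.

Lemma maurer_cartan_abelian (A : glocal K) (x : LM L A 1) :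
  maurer_cartan x <-> LM_diff x = 0.
Proof. by rewrite /maurer_cartan LM_br_abelian scaler0 addr0. Qed.

(** Only the term [n = 0] of the exponential series survives, and it is [- d a]. *)
Lemma gauge_abelian (A : glocal K) (a : LM L A 0) (b b' : LM L A 1) :
  gauge a b b' <-> b' = b - LM_diff a.
Proof.
have E M : \sum_(n < M.+1) gauge_term a b n = - LM_diff a :> LM L A 1.
  rewrite big_ord_recl big1 => [|i _].
    rewrite addr0 /gauge_term /= invr1 scale1r /LM_ad.
    by rewrite (LM_br_abelian a b : LM_br a b = 0 :> LM L A 1) add0r.
  rewrite /gauge_term /= /LM_ad.
  by rewrite (@LM_br_abelian A 0 1 a _); apply: scaler0.
split=> [[N /(_ N.+1 (leqnSn N)) ->]|->]; first by rewrite E.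
by exists 1%N => -[//|M] _; rewrite E.
Qed.
End AbelianGauge.

Theorem proposition5p8 (R : realType) (K : fieldType)
    (hK : K = (R : fieldType) \/ K = (R[i] : fieldType))
    (L : dgla K)
    (fin_coh : findim (total_cohomology L))
    (abel : labelian L) :
  prorepresentable (DefZ L).
Proof.
have K2 : 2%:R != 0 :> K by case: hK => ->; rewrite pnatr_eq0.
have [n [d [P [P_linear P_diff P_ker P_onto P_map]]]] := tensor_cohomology fin_coh.
exists (pslocal K d); split; first exact: pslocal_proartin.
pose coord (A : gart K) (x : mc L A) k := P A k (val x).
have coord_equiv (A : gart K) (x y : mc L A) : gauge_equiv x y -> forall k, coord A x k = coord A y k.
  move=> /asboolP xy k; elim: xy => {x y} // [x y [a /(gauge_abelian abel) E]|x y z _ -> _ ->//].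
  by rewrite /coord E (linB (P_linear A k)) P_diff subr0.
have coord_repr (A : gart K) (x : mc L A) k : coord A (repr (\pi_(Def_obj L A)%qT x)) k = coord A x k.
  apply: coord_equiv.
  by rewrite -[gauge_equiv _ _]/((@gauge_equiv_rel K L A) _ _) -eqmodE reprK.
have ex (A : gart K) (X : Def_obj L A) : exists h : lhom (pslocal K d) A,
    forall k, h _ (psvar K d k) = val (coord A (repr X) k).
  by apply: lhom_extension => // k; apply: submodP.
pose eta A (X : Def_obj L A) := projT1 (cid (ex A X)).
have etaE A X k : eta A X _ (psvar K d k) = val (coord A (repr X) k).
  exact: (projT2 (cid (ex A X))).
exists eta; split=> [A|A B f X]; last first.
  apply: lhom_eq_vars => k; apply: etrans (congr1 (f (d k)) (esym (etaE A X k))).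
  rewrite etaE [Fmap f X]/(Def_map f X) /Def_map coord_repr.
  by rewrite /coord [val (mc_map _ _)]/(LM_map f _) P_map.
have eta_inj : injective (eta A).
  move=> X Y XY; have cXY k : coord A (repr X) k = coord A (repr Y) k.
    by apply: val_inj; rewrite -!etaE XY.
  have cocycle (x : mc L A) : LM_diff (val x) = 0.
    by apply/(maurer_cartan_abelian abel)/asboolP; apply: (valP x).
  have [|k|a aE] := P_ker A (val (repr X) - val (repr Y)).
  - by rewrite (linB (@LM_diff_linear K L A 1)) !cocycle subrr.
  - by rewrite (linB (P_linear A k)) [P A k _]cXY subrr.
  rewrite -[X]reprK -[Y]reprK; apply/eqP; rewrite eqmodE; apply/asboolP.
  apply: rst_step; exists a; apply/(gauge_abelian abel).
  by rewrite -aE opprB addrC subrK.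
have eta_surj h : exists X, eta A X = h.
  pose xs k : mxm A (d k) := to_submod (lfun_local h (psvar_max K d k)).
  have [x [/(maurer_cartan_abelian abel) mcx xE]] := P_onto A xs.
  exists (\pi_(Def_obj L A)%qT (exist _ x (asboolT mcx))); apply: lhom_eq_vars => k.
  by rewrite etaE coord_repr /coord xE.
have [g gE] := choice eta_surj; exists g => // X.
by apply: eta_inj; rewrite gE.
Qed.
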